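(* Let $R,S$ be semiperfect linearly topologized rings satisfying Fitting's Property and let $M$ be an $(R,S)$-bimodule such that $\bigcap_{I,J}(IM+MJ)=0$, where $I$ ranges over the open ideals of $R$ and $J$ ranges over the open ideals of $S$. Then every $(R,S)$-bilinear pairing $\omega:A\times B\to M$, with $A$ a Hausdorff finitely presented left $R$-module and $B$ a Hausdorff finitely presented right $S$-module, can be written as an orthogonal sum of indecomposable bilinear pairings $\omega=\omega_1\perp\dots\perp\omega_t$, and this decomposition is essentially unique: if $\omega=\omega'_1\perp\dots\perp\omega'_{t'}$ with $\omega'_1,\dots,\omega'_{t'}$ indecomposable, then $t=t'$ and, after suitable reordering, $\omega_i$ is isometric to $\omega'_i$ for all $1\le i\le t$.
   Context: Rings are unital. A ring $R$ is semiperfect if there are pairwise orthogonal idempotents $e_1,\dots,e_t$ with $\sum_ie_i=1$ and every $e_iRe_i$ local. A topological ring is linearly topologized (LT) if it has a basis of neighborhoods of $0$ consisting of two-sided ideals; $\mathcal{I}_R$ denotes the set of open two-sided ideals of $R$. A Hausdorff LT ring $R$ has Fitting's Property if for every $n\ge1$ and $a\in\mathrm{M}_n(R)$ (with the product topology of $R^{n^2}$) there is an idempotent $e\in\mathrm{M}_n(R)$ such that $a=eae+(1-e)a(1-e)$, $eae$ is invertible in $e\mathrm{M}_n(R)e$, and $(1-e)a^k(1-e)\to0$ as $k\to\infty$. (Rings satisfying Fitting's Property are in particular Hausdorff.) A right $S$-module $B$ is Hausdorff if $\bigcap_{J\in\mathcal{I}_S}BJ=0$; a left $R$-module $A$ is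 Hausdorff if $\bigcap_{I\in\mathcal{I}_R}IA=0$. An $(R,S)$-bilinear pairing taking values in $M$ is a biadditive map $\omega:A\times B\to M$, with $A$ a left $R$-module and $B$ a right $S$-module, such that $\omega(ra,bs)=r\,\omega(a,b)\,s$ for all $a\in A$, $b\in B$, $r\in R$, $s\in S$. Two pairings $\omega_i:A_i\times B_i\to M$ ($i=1,2$) are isometric if there are module isomorphisms $f:A_1\to A_2$ and $g:B_1\to B_2$ such that $\omega_2(fa,gb)=\omega_1(a,b)$ for all $a\in A_1$, $b\in B_1$. The orthogonal sum $\omega_1\perp\omega_2:(A_1\oplus A_2)\times(B_1\oplus B_2)\to M$ is given by $(\omega_1\perp\omega_2)((a_1,a_2),(b_1,b_2))=\omega_1(a_1,b_1)+\omega_2(a_2,b_2)$, and decompositions are understood up to isometry. The zero object among pairings is the pairing on $0\times0$ (so a pairing with exactly one of $A,B$ zero is not the zero object); a pairing is indecomposable if it is not this zero object and is not isometric to an orthogonal sum of two pairings both different from the zero object. An empty orthogonal sum is the zero object. *)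

(* Defs.v *)
From HB Require Import structures.
From mathcomp Require Import all_boot all_algebra.
From mathcomp Require Import all_classical.
From mathcomp Require Import topology tvs.

Set Implicit Arguments.
Unset Strict Implicit.
Unset Printing Implicit Defensive.

Import GRing.Theory.

Local Open Scope classical_set_scope.
Local Open Scope ring_scope.

(* Rings are pzRingType, so the zero ring is included. *)
HB.mixin Record TopologicalZmodule_isTopologicalPzRing R
    & TopologicalZmodule R & GRing.PzRing R := {
  mul_continuous : continuous (fun x : R * R => x.1 * x.2)
}.

#[short(type="topologicalPzRingType")]
HB.structure Definition TopologicalPzRing :=
  {R of TopologicalZmodule R & GRing.PzRing R
      & TopologicalZmodule_isTopologicalPzRing R}.

(* Right S-modules are left modules over the converse ring S^c: for b : B with
   B : lmodType S^c, the right multiple bs is s *: b. A bimodule carries two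
   actions, so its right one is a separate operation bimod_ract. *)
HB.mixin Record Lmodule_isBimodule (R S : pzRingType) M
    & GRing.Lmodule R M := {
  bimod_ract : M -> S -> M;
  bimod_ractA : forall m s s', bimod_ract (bimod_ract m s) s' = bimod_ract m (s * s');
  bimod_ract1 : forall m, bimod_ract m 1 = m;
  bimod_ractDl : forall m m' s, bimod_ract (m + m') s = bimod_ract m s + bimod_ract m' s;
  bimod_ractDr : forall m s s', bimod_ract m (s + s') = bimod_ract m s + bimod_ract m s';
  bimod_ract_scale : forall r m s, bimod_ract (r *: m) s = r *: bimod_ract m s
}.

#[short(type="bimodType")]
HB.structure Definition Bimodule (R S : pzRingType) :=
  {M of GRing.Lmodule R M & Lmodule_isBimodule R S M}.

Definition is_idempotent (R : pzRingType) (e : R) : Prop := e * e = e.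

(* The ring eRe, whose identity is e. *)
Definition corner (R : pzRingType) (e : R) : set R :=
  [set e * x * e | x in [set: R]].

Definition corner_invertible (R : pzRingType) (e x : R) : Prop :=
  exists2 y, corner e y & x * y = e /\ y * x = e.

(* eRe is a local ring, in the noncommutative sense: it is nontrivial and a sum
   of two non-units is a non-unit. Units of eRe are relative to its identity e. *)
Definition corner_local (R : pzRingType) (e : R) : Prop :=
  e <> 0 /\
  forall x y, corner e x -> corner e y ->
    ~ corner_invertible e x -> ~ corner_invertible e y ->
    ~ corner_invertible e (x + y).

Definition semiperfect (R : pzRingType) : Prop :=
  exists (t : nat) (e : 'I_t -> R),
    [/\ forall i, is_idempotent (e i),
        forall i j, i != j -> e i * e j = 0,
        \sum_(i < t) e i = 1 &
        forall i, corner_local (e i)].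

Definition two_sided_ideal (R : pzRingType) (I : set R) : Prop :=
  [/\ I 0,
      forall x y, I x -> I y -> I (x - y),
      forall r x, I x -> I (r * x) &
      forall x r, I x -> I (x * r)].

Definition open_ideals (R : topologicalPzRingType) : set (set R) :=
  [set I | open I /\ two_sided_ideal I].

Definition linearly_topologized (R : topologicalPzRingType) : Prop :=
  forall U : set R, nbhs 0 U ->
    exists2 I, nbhs 0 I /\ two_sided_ideal I & I `<=` U.

Definition fitting_property (R : topologicalPzRingType) : Prop :=
  hausdorff_space R /\
  forall n : nat, (1 <= n)%N -> forall a : 'M[R]_n,
    exists e : 'M[R]_n,
      [/\ is_idempotent e,
          a = e * a * e + (1 - e) * a * (1 - e),
          corner_invertible e (e * a * e) &
          (fun k : nat => (1 - e) * a ^+ k * (1 - e)) @ \oo --> (0 : 'M[R]_n)].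

Definition add_span (V : zmodType) (X : set V) : set V :=
  [set v | exists (n : nat) (x : 'I_n -> V),
     (forall i, X (x i)) /\ v = \sum_(i < n) x i].

(* The additive subgroups IA, BJ, IM and MJ. *)
Definition lideal_mul (R : pzRingType) (I : set R) (A : lmodType R) : set A :=
  add_span [set r *: a | r in I & a in [set: A]].

Definition rideal_mul (S : pzRingType) (B : lmodType S^c) (J : set S) : set B :=
  add_span [set (s : S^c) *: b | s in J & b in [set: B]].

Arguments lideal_mul {R} I A _.
Arguments rideal_mul {S} B J _.

Definition bimod_lideal_mul (R S : pzRingType) (I : set R)
    (M : bimodType R S) : set M :=
  lideal_mul I M.

Definition bimod_rideal_mul (R S : pzRingType) (M : bimodType R S)
    (J : set S) : set M :=
  add_span [set bimod_ract m s | m in [set: M] & s in J].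

Arguments bimod_lideal_mul {R S} I M _.
Arguments bimod_rideal_mul {R S} M J _.

Definition hausdorff_lmod (R : topologicalPzRingType) (A : lmodType R) : Prop :=
  \bigcap_(I in @open_ideals R) lideal_mul I A = [set 0].

Definition hausdorff_rmod (S : topologicalPzRingType) (B : lmodType S^c) :
    Prop :=
  \bigcap_(J in @open_ideals S) rideal_mul B J = [set 0].

Definition hausdorff_bimod (R S : topologicalPzRingType) (M : bimodType R S) :
    Prop :=
  \bigcap_(IJ in @open_ideals R `*` @open_ideals S)
    [set x + y | x in bimod_lideal_mul IJ.1 M & y in bimod_rideal_mul M IJ.2]
  = [set 0].

(* There is an exact sequence R^m -> R^n -> A -> 0. *)
Definition finitely_presented (R : pzRingType) (A : lmodType R) : Prop :=
  exists (n m : nat) (p : {linear 'rV[R]_n -> A})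
         (q : {linear 'rV[R]_m -> 'rV[R]_n}),
    set_surj [set: 'rV[R]_n] [set: A] p /\
    forall v, p v = 0 <-> exists w, v = q w.

Record pairing (R S : pzRingType) (M : bimodType R S) := Pairing {
  pairing_l : lmodType R;
  pairing_r : lmodType S^c;
  pairing_form :> pairing_l -> pairing_r -> M;
  pairingDl : forall a a' b,
    pairing_form (a + a') b = pairing_form a b + pairing_form a' b;
  pairingDr : forall a b b',
    pairing_form a (b + b') = pairing_form a b + pairing_form a b';
  pairingZ : forall (r : R) (s : S) a b,
    pairing_form (r *: a) ((s : S^c) *: b) = r *: bimod_ract (pairing_form a b) s
}.

Definition isometric (R S : pzRingType) (M : bimodType R S)
    (w1 w2 : pairing M) : Prop :=
  exists (f : {linear pairing_l w1 -> pairing_l w2})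
         (g : {linear pairing_r w1 -> pairing_r w2}),
    [/\ bijective f, bijective g & forall a b, w2 (f a) (g b) = w1 a b].

Fact bimod_ract0 (R S : pzRingType) (M : bimodType R S) (s : S) :
  bimod_ract (0 : M) s = 0.
Proof. by apply: (addrI (bimod_ract 0 s)); rewrite -bimod_ractDl !addr0. Qed.

Definition zero_pairing (R S : pzRingType) (M : bimodType R S) : pairing M.
Proof.
exists 'rV[R]_0 'rV[S^c]_0 (fun _ _ => 0) => //.
- by move=> *; rewrite addr0.
- by move=> *; rewrite addr0.
- by move=> *; rewrite bimod_ract0 scaler0.
Defined.

Definition orthogonal_sum (R S : pzRingType) (M : bimodType R S)
    (w1 w2 : pairing M) : pairing M.
Proof.
exists (pairing_l w1 * pairing_l w2)%type (pairing_r w1 * pairing_r w2)%type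
  (fun a b => w1 a.1 b.1 + w2 a.2 b.2).
- by move=> a a' b /=; rewrite !pairingDl addrACA.
- by move=> a b b' /=; rewrite !pairingDr addrACA.
- by move=> r s a b /=; rewrite !pairingZ bimod_ractDl scalerDr.
Defined.

Definition indecomposable (R S : pzRingType) (M : bimodType R S)
    (w : pairing M) : Prop :=
  ~ isometric w (zero_pairing M) /\
  ~ exists w1 w2 : pairing M,
      [/\ ~ isometric w1 (zero_pairing M),
          ~ isometric w2 (zero_pairing M) &
          isometric w (orthogonal_sum w1 w2)].

Definition orthogonal_sums (R S : pzRingType) (M : bimodType R S) (t : nat)
    (w : 'I_t -> pairing M) : pairing M :=
  \big[@orthogonal_sum R S M/zero_pairing M]_(i < t) w i.

(* Main.v *)
Require Import Defs.
From HB Require Import structures.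
From mathcomp Require Import all_boot all_algebra.
From mathcomp Require Import all_classical.
From mathcomp Require Import topology tvs.

Set Implicit Arguments.
Unset Strict Implicit.
Unset Printing Implicit Defensive.

Import GRing.Theory.
Local Open Scope classical_set_scope.
Local Open Scope ring_scope.

(* Pairings form an additive category in which a morphism w1 -> w2 is an
   adjoint pair (A1 -> A2, B2 -> B1); its isomorphisms are the isometries, its
   biproducts the orthogonal sums, and idempotents split. Krull-Schmidt in it
   follows from two facts.
   Finiteness: over a semiperfect ring A and B are generated by finitely many
   elements x = e x with e a local idempotent, and an exchange argument bounds
   the number of coindependent maximal submodules, hence that of orthogonal
   nonzero idempotents.
   Locality: an endomorphism of A = coker(R^m -> R^n) lifts to matrices over
   R^n and R^m whose Fitting idempotents are intertwined by the presentation,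
   because the off-diagonal corners lie in all M(I); so it has a Fitting
   idempotent on A. For a self-adjoint pair the two Fitting idempotents are
   themselves adjoint, because the values w(e a, (1 - e') b) lie in all MJ.
   Applied to x and 1 - x, this makes End(w) an exchange ring, and so are the
   endomorphism rings of the summands of w; for an indecomposable summand the
   endomorphism ring is therefore local. *)

(** * The category of pairings *)

Lemma pair0r_linear (R : pzRingType) (V W : lmodType R) :
  linear (fun v : V => (v, 0) : V * W).
Proof.
move=> k x y; rewrite /GRing.add /GRing.scale /= /add_pair /scale_pair /=.
by rewrite scaler0 addr0.
Qed.

Lemma pair0l_linear (R : pzRingType) (V W : lmodType R) :
  linear (fun v : V => (0, v) : W * V).
Proof.
move=> k x y; rewrite /GRing.add /GRing.scale /= /add_pair /scale_pair /=.
by rewrite scaler0 addr0.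
Qed.

Section Category.
Variables (R S : pzRingType) (M : bimodType R S).
Implicit Types u v w X : pairing M.

(* The right component goes backwards, so that isometries (f, g) correspond to
   invertible morphisms (f, g^-1) and endomorphisms to self-adjoint pairs. *)
Record phom w1 w2 := PHom {
  homl : pairing_l w1 -> pairing_l w2;
  homr : pairing_r w2 -> pairing_r w1;
  homl_linear : linear homl;
  homr_linear : linear homr;
  hom_adj : forall a b, w2 (homl a) b = w1 a (homr b)
}.

HB.instance Definition _ w1 w2 (f : phom w1 w2) :=
  GRing.isLinear.Build R (pairing_l w1) (pairing_l w2) *:%R (homl f)
    (homl_linear f).
HB.instance Definition _ w1 w2 (f : phom w1 w2) :=
  GRing.isLinear.Build S^c (pairing_r w2) (pairing_r w1) *:%R (homr f)
    (homr_linear f).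

Lemma hom_eq w1 w2 (f g : phom w1 w2) :
  homl f =1 homl g -> homr f =1 homr g -> f = g.
Proof.
case: f g => [fl fr p1 p2 p3] [gl gr q1 q2 q3] /= /funext El /funext Er.
by subst gl gr; congr PHom; exact: Prop_irrelevance.
Qed.

Lemma pairing0l w b : w 0 b = 0.
Proof. by apply: (addrI (w 0 b)); rewrite -pairingDl !addr0. Qed.

Lemma pairing0r w a : w a 0 = 0.
Proof. by apply: (addrI (w a 0)); rewrite -pairingDr !addr0. Qed.

Lemma pairingNl w a b : w (- a) b = - w a b.
Proof. by apply: (addrI (w a b)); rewrite -pairingDl !subrr pairing0l. Qed.

Lemma pairingNr w a b : w a (- b) = - w a b.
Proof. by apply: (addrI (w a b)); rewrite -pairingDr !subrr pairing0r. Qed.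

Section HomZmod.
Variables w1 w2 : pairing M.
Implicit Types f g : phom w1 w2.

Definition hom0 : phom w1 w2.
Proof.
exists (fun _ => 0) (fun _ => 0).
- by move=> k x y; rewrite scaler0 addr0.
- by move=> k x y; rewrite scaler0 addr0.
- by move=> a b; rewrite pairing0l pairing0r.
Defined.

Definition homN f : phom w1 w2.
Proof.
exists (fun a => - homl f a) (fun b => - homr f b).
- by move=> k x y; rewrite linearP opprD scalerN.
- by move=> k x y; rewrite linearP opprD scalerN.
- by move=> a b; rewrite pairingNl pairingNr hom_adj.
Defined.

Definition homD f g : phom w1 w2.
Proof.
exists (fun a => homl f a + homl g a) (fun b => homr f b + homr g b).
- by move=> k x y; rewrite !linearP scalerDr addrACA.
- by move=> k x y; rewrite !linearP scalerDr addrACA.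
- by move=> a b; rewrite pairingDl pairingDr !hom_adj.
Defined.

HB.instance Definition _ := gen_eqMixin (phom w1 w2).
HB.instance Definition _ := gen_choiceMixin (phom w1 w2).

Fact homDA : associative homD.
Proof. by move=> f g h; apply: hom_eq => x; exact: addrA. Qed.
Fact homDC : commutative homD.
Proof. by move=> f g; apply: hom_eq => x; exact: addrC. Qed.
Fact hom0D : left_id hom0 homD.
Proof. by move=> f; apply: hom_eq => x; exact: add0r. Qed.
Fact homND : left_inverse hom0 homN homD.
Proof. by move=> f; apply: hom_eq => x; exact: addNr. Qed.

HB.instance Definition _ := GRing.isZmodule.Build (phom w1 w2)
  homDA homDC hom0D homND.

Lemma homlD f g a : homl (f + g) a = homl f a + homl g a. Proof. by []. Qed.
Lemma homrD f g b : homr (f + g) b = homr f b + homr g b. Proof. by []. Qed.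
Lemma homlN f a : homl (- f) a = - homl f a. Proof. by []. Qed.
Lemma homrN f b : homr (- f) b = - homr f b. Proof. by []. Qed.
Lemma homl0 a : homl (0 : phom w1 w2) a = 0. Proof. by []. Qed.
Lemma homr0 b : homr (0 : phom w1 w2) b = 0. Proof. by []. Qed.

End HomZmod.

Definition idhom w : phom w w.
Proof. by exists id id. Defined.

Definition hcomp w1 w2 w3 (f : phom w2 w3) (g : phom w1 w2) : phom w1 w3.
Proof.
exists (homl f \o homl g) (homr g \o homr f).
- by move=> k x y /=; rewrite !linearP.
- by move=> k x y /=; rewrite !linearP.
- by move=> a b /=; rewrite !hom_adj.
Defined.

Local Notation "f '**' g" := (hcomp f g) (at level 40, left associativity).
Local Notation "1" := (idhom _).

Section CompTheory.
Variables (w1 w2 w3 w4 : pairing M).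

Lemma hcompA (f : phom w3 w4) (g : phom w2 w3) (h : phom w1 w2) :
  f ** (g ** h) = f ** g ** h.
Proof. exact: hom_eq. Qed.

Lemma hcomp1m (f : phom w1 w2) : 1 ** f = f. Proof. exact: hom_eq. Qed.

Lemma hcompm1 (f : phom w1 w2) : f ** 1 = f. Proof. exact: hom_eq. Qed.

Lemma hcompDl (f g : phom w2 w3) (h : phom w1 w2) :
  (f + g) ** h = f ** h + g ** h.
Proof.
by apply: hom_eq => x; rewrite ?(homlD, homrD) /= ?(homlD, homrD) ?linearD.
Qed.

Lemma hcompDr (h : phom w2 w3) (f g : phom w1 w2) :
  h ** (f + g) = h ** f + h ** g.
Proof.
by apply: hom_eq => x; rewrite ?(homlD, homrD) /= ?(homlD, homrD) ?linearD.
Qed.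

Lemma hcompNl (f : phom w2 w3) (h : phom w1 w2) : (- f) ** h = - (f ** h).
Proof.
by apply: hom_eq => x; rewrite ?(homlN, homrN) /= ?(homlN, homrN) ?linearN.
Qed.

Lemma hcompNr (h : phom w2 w3) (f : phom w1 w2) : h ** (- f) = - (h ** f).
Proof.
by apply: hom_eq => x; rewrite ?(homlN, homrN) /= ?(homlN, homrN) ?linearN.
Qed.

Lemma hcompBl (f g : phom w2 w3) (h : phom w1 w2) :
  (f - g) ** h = f ** h - g ** h.
Proof. by rewrite hcompDl hcompNl. Qed.

Lemma hcompBr (h : phom w2 w3) (f g : phom w1 w2) :
  h ** (f - g) = h ** f - h ** g.
Proof. by rewrite hcompDr hcompNr. Qed.

Lemma hcomp0m (h : phom w1 w2) : (0 : phom w2 w3) ** h = 0.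
Proof.
by apply: hom_eq => x; rewrite ?(homl0, homr0) /= ?(homl0, homr0) ?linear0.
Qed.

Lemma hcompm0 (h : phom w2 w3) : h ** (0 : phom w1 w2) = 0.
Proof.
by apply: hom_eq => x; rewrite ?(homl0, homr0) /= ?(homl0, homr0) ?linear0.
Qed.

End CompTheory.

Definition piso w1 w2 := exists (f : phom w1 w2) (g : phom w2 w1),
  f ** g = 1 /\ g ** f = 1.

Lemma isometric_piso w1 w2 : isometric w1 w2 <-> piso w1 w2.
Proof.
split=> [[f [g [[f' fK f'K] [g' gK g'K] fg]]]|[f [g [fg gf]]]].
  have f'_lin := can2_linear fK f'K; have g'_lin := can2_linear gK g'K.
  have @F : phom w1 w2.
    exists f g' => // [k x y|a b]; first exact: linearP.
    by rewrite -{1}(g'K b) fg.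
  have @G : phom w2 w1.
    exists f' g => // [k x y|a b]; first exact: linearP.
    by rewrite -{2}(f'K a) fg.
  by exists F, G; split; apply: hom_eq.
exists (homl f), (homr g); split=> [||a b].
3: by rewrite hom_adj -[homr f _]/(homr (g ** f) b) gf.
  exists (homl g) => x; first by rewrite -[LHS]/(homl (g ** f) x) gf.
  by rewrite -[LHS]/(homl (f ** g) x) fg.
exists (homr f) => x; first by rewrite -[LHS]/(homr (g ** f) x) gf.
by rewrite -[LHS]/(homr (f ** g) x) fg.
Qed.

(** Both components of the identity must vanish, so a pairing with just one zero module is not a
    zero object. *)
Definition is_zero w := (1 : phom w w) = 0.

Lemma isometric_zero w : isometric w (zero_pairing M) = is_zero w.
Proof.
apply/propext; rewrite isometric_piso; split=> [[f [g [fg gf]]]|w0].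
  rewrite /is_zero -gf; apply: hom_eq => x /=.
    by rewrite [homl f x](_ : _ = 0) ?linear0//; apply/rowP => -[].
  by rewrite [homr g x](_ : _ = 0) ?linear0//; apply/rowP => -[].
exists 0, 0; split; last by rewrite hcomp0m w0.
by apply: hom_eq => x; apply/rowP => -[].
Qed.

(** Biproduct data internal to X, so that summands can be compared without an actual direct sum. *)
Definition biprod X w1 w2 := exists (i1 : phom w1 X) (p1 : phom X w1)
    (i2 : phom w2 X) (p2 : phom X w2),
  [/\ p1 ** i1 = 1, p2 ** i2 = 1, p1 ** i2 = 0, p2 ** i1 = 0 &
      i1 ** p1 + i2 ** p2 = 1].

Lemma biprod_orthogonal_sum w1 w2 : biprod (orthogonal_sum w1 w2) w1 w2.
Proof.
have @i1 : phom w1 (orthogonal_sum w1 w2).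
  exists (fun a => (a, 0)) fst => //.
  - exact: pair0r_linear.
  - by move=> a b /=; rewrite pairing0l addr0.
have @i2 : phom w2 (orthogonal_sum w1 w2).
  exists (fun a => (0, a)) snd => //.
  - exact: pair0l_linear.
  - by move=> a b /=; rewrite pairing0l add0r.
have @p1 : phom (orthogonal_sum w1 w2) w1.
  exists fst (fun a => (a, 0)) => //.
  - exact: pair0r_linear.
  - by move=> a b /=; rewrite pairing0r addr0.
have @p2 : phom (orthogonal_sum w1 w2) w2.
  exists snd (fun a => (0, a)) => //.
  - exact: pair0l_linear.
  - by move=> a b /=; rewrite pairing0r add0r.
exists i1, p1, i2, p2; split; apply: hom_eq => //= -[x y];
  by rewrite /GRing.add /= /add_pair /= addr0 add0r.
Qed.

Lemma biprod_piso X Y w1 w2 : piso X Y -> biprod Y w1 w2 -> biprod X w1 w2.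
Proof.
move=> [f [g [fg gf]]] [i1 [p1 [i2 [p2 [p11 p22 p12 p21 ip]]]]].
exists (g ** i1), (p1 ** f), (g ** i2), (p2 ** f).
have fgK w (h : phom w Y) : f ** (g ** h) = h by rewrite hcompA fg hcomp1m.
rewrite -!hcompA !fgK; split=> //.
by rewrite !hcompA -hcompDl -!(hcompA g) -hcompDr ip hcompm1.
Qed.

Lemma biprod_unique X Y w1 w2 : biprod X w1 w2 -> biprod Y w1 w2 -> piso X Y.
Proof.
move=> [i1 [p1 [i2 [p2 [p11 p22 p12 p21 ip]]]]].
move=> [j1 [q1 [j2 [q2 [q11 q22 q12 q21 jq]]]]].
exists (j1 ** p1 + j2 ** p2), (i1 ** q1 + i2 ** q2).
rewrite !hcompDl !hcompDr -!hcompA.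
rewrite !(hcompA p1) !(hcompA p2) !(hcompA q1) !(hcompA q2).
rewrite p11 p22 p12 p21 q11 q22 q12 q21.
by rewrite !hcomp0m !hcompm0 !hcomp1m !addr0 !add0r.
Qed.

Lemma isometric_orthogonal_sum X w1 w2 :
  isometric X (orthogonal_sum w1 w2) <-> biprod X w1 w2.
Proof.
rewrite isometric_piso; split=> [XY|Xw].
  exact: biprod_piso XY (biprod_orthogonal_sum w1 w2).
exact: biprod_unique Xw (biprod_orthogonal_sum w1 w2).
Qed.

End Category.

(** * Splitting idempotents *)

Section FixedSubmodule.
Variables (R : pzRingType) (A : lmodType R) (f : {linear A -> A}).

(** For idempotent [f] the fixed points are the image; as a boolean predicate they give a subtype
    with the module structure. *)
Definition fixed : {pred A} := fun a => f a == a.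

Fact fixed_submod_closed : submod_closed fixed.
Proof.
split=> [|k x y /eqP fx /eqP fy]; rewrite unfold_in ?linear0//.
by rewrite linearP fx fy.
Qed.

HB.instance Definition _ :=
  GRing.isSubmodClosed.Build R A fixed fixed_submod_closed.

Record fixmod := Fixmod { fixmod_val : A; _ : fixmod_val \in fixed }.

HB.instance Definition _ := [isSub for fixmod_val].
HB.instance Definition _ := [Choice of fixmod by <:].
HB.instance Definition _ := [SubChoice_isSubLmodule of fixmod by <:].

Lemma fixmodP (u : fixmod) : f (val u) = val u.
Proof. exact/eqP/(valP u). Qed.

Variable f_idem : forall a, f (f a) = f a.

Definition to_fixmod a : fixmod := Fixmod (introT eqP (f_idem a)).

Lemma to_fixmodK u : to_fixmod (val u) = u.
Proof. by apply: val_inj; exact: fixmodP. Qed.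

Lemma to_fixmod_linear : linear to_fixmod.
Proof. by move=> k x y; apply: val_inj; rewrite /= linearP. Qed.

End FixedSubmodule.

Section Decomposition.
Variables (R S : pzRingType) (M : bimodType R S).
Implicit Types u v w X : pairing M.
Local Notation "f '**' g" := (hcomp f g) (at level 40, left associativity).
Local Notation "1" := (idhom _).

(** X restricts to the images of both components of e. As these are adjoint, the inclusion on one
    side is adjoint to the projection on the other. *)
Lemma idempotent_split X (e : phom X X) : e ** e = e ->
  exists w (i : phom w X) (p : phom X w), p ** i = 1 /\ i ** p = e.
Proof.
move=> ee.
have el a : homl e (homl e a) = homl e a by rewrite -{3}ee.
have er b : homr e (homr e b) = homr e b by rewrite -{3}ee.
have @w : pairing M.
  exists (fixmod (homl e)) (fixmod (homr e)) (fun a b => X (val a) (val b)).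
  - by move=> a a' b; rewrite linearD pairingDl.
  - by move=> a b b'; rewrite linearD pairingDr.
  - by move=> r s a b; rewrite !linearZ pairingZ.
have @i : phom w X.
  exists val (to_fixmod er); first exact: linearP.
    exact: to_fixmod_linear.
  by move=> a b /=; rewrite -hom_adj fixmodP.
have @p : phom X w.
  exists (to_fixmod el) val; first exact: to_fixmod_linear.
    exact: linearP.
  by move=> a b /=; rewrite hom_adj fixmodP.
by exists w, i, p; split; apply: hom_eq => //= a; exact: to_fixmodK.
Qed.

Definition retract w X := exists (i : phom w X) (p : phom X w), p ** i = 1.

Lemma retract_trans w v X : retract w v -> retract v X -> retract w X.
Proof.
move=> [i [p pi1]] [j [q qj1]]; exists (j ** i), (p ** q).
by rewrite -hcompA (hcompA q) qj1 hcomp1m.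
Qed.

Lemma biprod_retract1 X w1 w2 : biprod X w1 w2 -> retract w1 X.
Proof. by move=> [i [p [? [? []]]]]; exists i, p. Qed.

Lemma biprod_retract2 X w1 w2 : biprod X w1 w2 -> retract w2 X.
Proof. by move=> [? [? [i [p []]]]]; exists i, p. Qed.

(** The complement v splits the idempotent 1 - i p. *)
Lemma split_biprod X w (i : phom w X) (p : phom X w) : p ** i = 1 ->
  exists v (j : phom v X) (q : phom X v),
    [/\ q ** j = 1, p ** j = 0, q ** i = 0 & i ** p + j ** q = 1].
Proof.
move=> pi1.
have ipip : i ** p ** (i ** p) = i ** p.
  by rewrite -hcompA (hcompA p) pi1 hcomp1m.
have : (idhom X - i ** p) ** (idhom X - i ** p) = idhom X - i ** p.
  by rewrite hcompBl !hcompBr ipip !hcomp1m !hcompm1 subrr subr0.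
move=> /idempotent_split[v [j [q [qj jq]]]]; exists v, j, q; split=> //.
- rewrite -[p ** j]hcompm1 -qj -hcompA (hcompA j) jq !hcompA hcompBr hcompm1.
  by rewrite hcompA pi1 hcomp1m subrr hcomp0m.
- rewrite -[q ** i]hcomp1m -qj -hcompA (hcompA j) jq hcompBl hcomp1m.
  by rewrite -hcompA pi1 hcompm1 subrr hcompm0.
- by rewrite jq addrC subrK.
Qed.

Lemma retract_biprod w X : retract w X -> exists v, biprod X w v.
Proof.
move=> [i [p pi1]]; have [v [j [q [qj pj qi ijq]]]] := split_biprod pi1.
by exists v, i, p, j, q.
Qed.

(** Since idempotents split, proper summands of w come from idempotents of End(w) other than 0 and
    1. *)
Lemma indecomposableP w : indecomposable w <->
  ~ is_zero w /\ forall e : phom w w, e ** e = e -> e = 0 \/ e = 1.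
Proof.
rewrite /indecomposable isometric_zero; split=> -[w0 H]; split=> //.
  move=> e ee; have [v [i [p [pi1 ip]]]] := idempotent_split ee.
  have [v' [j [q [qj pj qi ijq]]]] := split_biprod pi1.
  have [v0|v0] := pselect (is_zero v).
    by left; rewrite -ip -[i]hcompm1 v0 hcompm0 hcomp0m.
  have [v'0|v'0] := pselect (is_zero v').
    by right; rewrite -ip -ijq -[j]hcompm1 v'0 hcompm0 hcomp0m addr0.
  case: H; exists v, v'; rewrite !isometric_zero; split=> //.
  by apply/isometric_orthogonal_sum; exists i, p, j, q.
move=> [w1 [w2 []]]; rewrite !isometric_zero => w1n0 w2n0.
move=> /isometric_orthogonal_sum[i [p [j [q [pi1 qj pj qi ijq]]]]].
have ipip : i ** p ** (i ** p) = i ** p.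
  by rewrite -hcompA (hcompA p) pi1 hcomp1m.
case: (H _ ipip) => ip.
  apply: w1n0; rewrite /is_zero -[LHS]pi1 -[p in LHS]hcomp1m -pi1.
  by rewrite -(hcompA p) ip hcompm0 hcomp0m.
apply: w2n0; rewrite /is_zero -[LHS]qj -[j in LHS]hcomp1m -ip.
by rewrite -hcompA pj !hcompm0.
Qed.

(** Write the identity of X as a 2 x 2 block matrix from w1 + w2 to v1 + v2. Its block q1 i1 has
    inverse c, so the Schur complement q2 i2 - q2 i1 c q1 i2 is invertible; its inverse is the block
    p2 j2 of the inverse matrix. *)
Lemma biprod_cancel X w1 w2 v1 v2 (i1 : phom w1 X) (p1 : phom X w1)
    (i2 : phom w2 X) (p2 : phom X w2) (j1 : phom v1 X) (q1 : phom X v1)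
    (j2 : phom v2 X) (q2 : phom X v2) (c : phom v1 w1) :
  p1 ** i2 = 0 -> p2 ** i1 = 0 -> p2 ** i2 = 1 -> i1 ** p1 + i2 ** p2 = 1 ->
  q1 ** j2 = 0 -> q2 ** j2 = 1 -> j1 ** q1 + j2 ** q2 = 1 ->
  c ** (q1 ** i1) = 1 -> q1 ** i1 ** c = 1 ->
  piso w2 v2.
Proof.
move=> p12 p21 p22 ip q12 q22 jq ca ac.
have ip2 : i2 ** p2 = idhom X - i1 ** p1 by rewrite -ip addrC addKr.
have jq2 : j2 ** q2 = idhom X - j1 ** q1 by rewrite -jq addrC addKr.
have E1 : i2 ** (p2 ** j2) = j2 - i1 ** (p1 ** j2).
  by rewrite hcompA ip2 hcompBl hcomp1m -hcompA.
have E2 : j2 ** (q2 ** i2) = i2 - j1 ** (q1 ** i2).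
  by rewrite hcompA jq2 hcompBl hcomp1m -hcompA.
exists (q2 ** i2 - q2 ** i1 ** c ** (q1 ** i2)), (p2 ** j2); split.
  rewrite hcompBl -!hcompA E1 !hcompBr q22 q12 !hcompm0 sub0r opprK.
  rewrite (hcompA q1 i1) (hcompA c (q1 ** i1)) ca hcomp1m.
  by rewrite subrK.
rewrite hcompBr -!hcompA E2 (hcompA j2) jq2 hcompBl hcomp1m !hcompBr p22.
rewrite (hcompA p2 i1) p21 hcomp0m sub0r opprK.
rewrite -!hcompA (hcompA q1 i1) (hcompA (q1 ** i1) c) ac hcomp1m.
by rewrite subrK.
Qed.

End Decomposition.

(** * Krull-Schmidt *)

Section KrullSchmidt.
Variables (R S : pzRingType) (M : bimodType R S).
Implicit Types u v w X : pairing M.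
Local Notation "f '**' g" := (hcomp f g) (at level 40, left associativity).
Local Notation "1" := (idhom _).

Lemma piso_refl X : piso X X.
Proof. by exists 1, 1; rewrite hcomp1m. Qed.

Lemma biprod_piso_r X w V V' : piso V V' -> biprod X w V -> biprod X w V'.
Proof.
move=> [f [g [fg gf]]] [i [p [j [q [pi1 qj pj qi ijq]]]]].
exists i, p, (j ** g), (f ** q); split=> //.
- by rewrite -!hcompA (hcompA q) qj hcomp1m.
- by rewrite hcompA pj hcomp0m.
- by rewrite -hcompA qi hcompm0.
- by rewrite -!hcompA (hcompA g) gf hcomp1m.
Qed.

(** Nicholson's criterion for End(w) to be an exchange ring, stated with right ideals. *)
Definition exchange w := forall x : phom w w, exists e y z : phom w w,
  [/\ e ** e = e, e = x ** y & idhom w - e = (idhom w - x) ** z].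

Lemma exchange_retract w X : retract w X -> exchange X -> exchange w.
Proof.
move=> [i [p pi1]] exX x; have [e [y [z [ee exy ez]]]] := exX (i ** x ** p).
(* e lies in i x p End(X), so i p fixes it and p e i is idempotent. *)
have ipe : i ** (p ** e) = e.
  by rewrite exy !hcompA -(hcompA i p i) pi1 hcompm1.
exists (p ** e ** i), (p ** y ** i), (p ** z ** i); split.
- rewrite !hcompA -(hcompA (p ** e)) -(hcompA (p ** e)) -(hcompA i) ipe.
  by rewrite -(hcompA p) ee.
- by rewrite exy !hcompA pi1 hcomp1m.
- transitivity (p ** (idhom X - e) ** i).
    by rewrite hcompBr hcompm1 hcompBl pi1.
  rewrite ez !hcompBl hcomp1m hcompBr hcompBl !hcompA pi1.
  by rewrite !hcomp1m.
Qed.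

Definition invertible w (x : phom w w) := exists c, x ** c = 1 /\ c ** x = 1.

(** c x is idempotent, hence 0 or 1, and 0 would force w to be zero. *)
Lemma indecomposable_right_inverse w (x c : phom w w) :
  indecomposable w -> x ** c = 1 -> invertible x.
Proof.
move=> /indecomposableP[w0 H] xc; exists c; split=> //.
have: c ** x ** (c ** x) = c ** x by rewrite -hcompA (hcompA x) xc hcomp1m.
case/H => // cx; case: w0; rewrite /is_zero.
by rewrite -[LHS]hcomp1m -[in LHS]xc -hcompA (hcompA c) cx hcomp0m hcompm0.
Qed.

(** The exchange idempotent is 0 or 1, so 1 - x or x has a right inverse, which is then
    two-sided. *)
Lemma exchange_local w (x y : phom w w) : indecomposable w -> exchange w ->
  x + y = 1 -> invertible x \/ invertible y.
Proof.
move=> indw exw xy; have ->: y = idhom w - x by rewrite -xy addrC addKr.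
have [e [c [d [ee exc ed]]]] := exw x.
case: (indecomposableP w) => /(_ indw)[_ /(_ e ee)[e0|e1]] _.
  right; apply: (indecomposable_right_inverse (c := d) indw).
  by rewrite -ed e0 subr0.
by left; apply: (indecomposable_right_inverse (c := c) indw); rewrite -exc.
Qed.

(** The nesting of [orthogonal_sums], with each tail replaced by an arbitrary complement V. *)
Fixpoint sumdec X (t : nat) : ('I_t -> pairing M) -> Prop :=
  match t with
  | 0 => fun=> is_zero X
  | t'.+1 => fun w : 'I_t'.+1 -> pairing M => exists2 V, biprod X (w ord0) V &
                        @sumdec V t' (fun i => w (lift ord0 i))
  end.

Lemma is_zero_piso X Y : piso X Y -> is_zero Y -> is_zero X.
Proof.
move=> [f [g [fg gf]]] Y0.
by rewrite /is_zero -gf -[f]hcomp1m Y0 hcomp0m hcompm0.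
Qed.

Lemma sumdec_piso X Y t (w : 'I_t -> pairing M) :
  piso X Y -> sumdec Y w -> sumdec X w.
Proof.
case: t w => [|t] w XY /=; first exact: is_zero_piso.
by move=> [V YV dV]; exists V => //; exact: biprod_piso YV.
Qed.

Lemma isometric_orthogonal_sums X t (w : 'I_t -> pairing M) :
  isometric X (orthogonal_sums w) <-> sumdec X w.
Proof.
elim: t X w => [|t IH] X w; rewrite /orthogonal_sums.
  by rewrite big_ord0 isometric_zero.
rewrite big_ord_recl -/(orthogonal_sums _) /=.
rewrite isometric_orthogonal_sum; split=> [XV|[V XV /IH/isometric_piso dV]].
  eexists; first exact: XV.
  by apply/IH/isometric_piso; exact: piso_refl.
exact: biprod_piso_r XV.
Qed.

Lemma lift0K t (j : 'I_t.+1) : lift (lift ord0 j) ord0 = ord0.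
Proof. exact/val_inj. Qed.

Lemma lift_lift0 t (j : 'I_t.+1) (i : 'I_t) :
  lift (lift ord0 j) (lift ord0 i) = lift ord0 (lift j i).
Proof. by apply/val_inj; rewrite /= /bump /= !add1n ltnS addnS. Qed.

(* The composites u -> v -> u and u -> V -> u add up to 1 in the local ring
   End(u), so one of them is invertible. *)
Lemma biprod_exchange X u W v V :
  indecomposable u -> exchange u -> indecomposable v ->
  biprod X u W -> biprod X v V ->
  (piso u v /\ piso W V) \/ (exists2 V', biprod V u V' & biprod W v V').
Proof.
move=> indu exu indv [i [p [i2 [p2 [pi1 pi2 pi12 pi21 ip]]]]].
move=> [j1 [q1 [j2 [q2 [q11 q22 q12 q21 jq]]]]].
have [u0 _] := (indecomposableP u).1 indu.
have [|[c [_ cx]]|[c [_ cx]]] := @exchange_local u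
  (p ** (j1 ** q1) ** i) (p ** (j2 ** q2) ** i) indu exu.
- by rewrite -hcompDl -hcompDr jq hcompm1.
- left; set a := q1 ** i; set b := c ** p ** j1.
  have ba : b ** a = 1 by rewrite -cx !hcompA.
  (* a b is an idempotent of End(v), nonzero because b a = 1 on the nonzero u; as v is
     indecomposable, it is 1. *)
  have ab : a ** b = 1.
    have abab : a ** b ** (a ** b) = a ** b.
      by rewrite -hcompA (hcompA b) ba hcomp1m.
    case: ((indecomposableP v).1 indv) => _ /(_ _ abab)[ab0|//].
    case: u0; rewrite /is_zero -[LHS]ba -[b in LHS]hcomp1m -ba.
    by rewrite -(hcompA b) ab0 hcompm0 hcomp0m.
  split; first by exists a, b.
  exact: biprod_cancel pi12 pi21 pi2 ip q12 q22 jq ba ab.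
- right; set m := q2 ** i; set n := c ** p ** j2.
  have nm : n ** m = 1 by rewrite -cx !hcompA.
  have nqi : n ** q2 ** i = 1 by rewrite -hcompA.
  clearbody m n.
  have [V' [k [l [lk nk lm mnkl]]]] := split_biprod nm.
  exists V'; first by exists m, n, k, l.
  have := biprod_orthogonal_sum v V'; set Z := orthogonal_sum v V'.
  move=> bZ; have [a [a' [b [b' [aa bb ab ba abZ]]]]] := bZ.
  (* Both W and Z complement u in X, with u embedded by i and by j2 m respectively. The component n
     q2 i between the two copies is 1, so u cancels. *)
  suff /biprod_piso : piso W Z by apply.
  apply: (@biprod_cancel _ _ _ X u W u Z i p i2 p2 (j2 ** m) (n ** q2)
    (j1 ** a' + j2 ** k ** b') (a ** q1 + b ** l ** q2) 1) => //.
  + rewrite hcompDr !hcompA -!(hcompA n) q21 q22 !hcomp0m hcomp1m hcompm0.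
    by rewrite add0r (hcompA n) nk hcomp0m.
  + rewrite hcompDl !hcompDr !hcompA -!(hcompA a) -!(hcompA (b ** l)).
    rewrite q11 q12 q21 q22 !hcomp0m !hcompm0 !hcomp1m addr0 add0r.
    by rewrite hcompA -(hcompA b) lk hcompm1.
  + rewrite hcompDl !hcompDr !hcompA -!(hcompA j1) -!(hcompA (j2 ** k)).
    rewrite aa ab ba bb !hcomp0m !hcompm0 !hcomp1m addr0 add0r addrCA.
    by rewrite !hcompA -hcompDl -!(hcompA j2) -hcompDr mnkl hcompm1.
  + by rewrite hcomp1m.
  + by rewrite hcompm1.
Qed.

(** Compare u with the first summand. Either they cancel, or u is a summand of the tail V, where the
    induction applies, and the first summand of X is one of W. *)
Lemma krull_schmidt_exchange t (w : 'I_t.+1 -> pairing M) X u W :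
  (forall i, indecomposable (w i)) -> indecomposable u -> exchange u ->
  biprod X u W -> sumdec X w ->
  exists j, piso u (w j) /\ sumdec W (fun i => w (lift j i)).
Proof.
elim: t w X W => [|t IH] w X W indw indu exu XuW [V XwV dV].
all: have [[uw WV]|[V' VuV' WwV']] :=
  biprod_exchange indu exu (indw ord0) XuW XwV.
1,3: exists ord0; split=> //.
1,2: exact: (@sumdec_piso _ _ _ (fun i => w (lift ord0 i)) WV dV).
  (* With a single summand V is zero and cannot contain u. *)
  have [u0 _] := (indecomposableP u).1 indu.
  have [i [p [_ [_ [pi1 _ _ _ _]]]]] := VuV'.
  by case: u0; rewrite /is_zero -pi1 -[p]hcompm1 dV hcompm0 hcomp0m.
have [j [uj dV']] := IH _ _ _ (fun i => indw (lift ord0 i)) indu exu VuV' dV.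
exists (lift ord0 j); split=> //; exists V'; first by rewrite lift0K.
by under eq_fun => i do rewrite lift_lift0.
Qed.

(** The first w matches some w' j; deleting both leaves two decompositions of the complement W,
    which inherits the exchange property. *)
Lemma krull_schmidt X t t' (w : 'I_t -> pairing M) (w' : 'I_t' -> pairing M) :
  exchange X ->
  (forall i, indecomposable (w i)) -> sumdec X w ->
  (forall i, indecomposable (w' i)) -> sumdec X w' ->
  t = t' /\ exists sigma : 'I_t -> 'I_t', bijective sigma /\
    forall i, piso (w i) (w' (sigma i)).
Proof.
elim: t t' X w w' => [|t IH] [|t'] X w w' exX indw dw indw' dw'.
- by split=> //; exists id; split=> [|[]//]; exists id.
- have [V /biprod_retract1[i [p pi1]] _] := dw'.
  case: ((indecomposableP _).1 (indw' ord0)) => /(_ _)[]//.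
  by rewrite /is_zero -pi1 -[p]hcompm1 [idhom X]dw hcompm0 hcomp0m.
- have [V /biprod_retract1[i [p pi1]] _] := dw.
  case: ((indecomposableP _).1 (indw ord0)) => /(_ _)[]//.
  by rewrite /is_zero -pi1 -[p]hcompm1 [idhom X]dw' hcompm0 hcomp0m.
have [W XwW dW] := dw.
have exw : exchange (w ord0).
  exact: exchange_retract (biprod_retract1 XwW) exX.
have [j [wj dW']] := krull_schmidt_exchange indw' (indw ord0) exw XwW dw'.
have exW : exchange W by exact: exchange_retract (biprod_retract2 XwW) exX.
have [tt' [s [s_bij ws]]] := IH t' W _ _ exW (fun i => indw _) dW
  (fun i => indw' _) dW'.
subst t'; split=> //.
exists (fun i => if unlift ord0 i is Some i' then lift j (s i') else j).
split=> [|i]; last by case: unliftP => [i'|] -> //=; exact: ws.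
apply: inj_card_bij => // i1 i2.
case: unliftP => [k1|] ->; case: unliftP => [k2|] -> //.
- by move=> /lift_inj/(bij_inj s_bij) ->.
- by move=> /esym/eqP; rewrite (negbTE (neq_lift _ _)).
- by move=> /eqP; rewrite (negbTE (neq_lift _ _)).
Qed.

(** The measure for the inductions that produce indecomposable summands. *)
Definition idempotent_bound w n := forall (I : finType) (e : I -> phom w w),
  (forall i, e i ** e i = e i) -> (forall i, e i <> 0) ->
  (forall i j, i != j -> e i ** e j = 0) -> (#|I| <= n)%N.

Lemma idempotent_bound0 w : idempotent_bound w 0 -> is_zero w.
Proof.
move=> bw; apply: contrapT => w0.
suff: (#|{: unit}| <= 0)%N by rewrite card_unit.
by apply: (bw _ (fun=> 1)) => [_|//|[] []//]; rewrite hcomp1m.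
Qed.

(** Idempotents of V transported to X are orthogonal to the nonzero i p, which takes the extra index
    [None]. *)
Lemma idempotent_bound_biprod X u V n : ~ is_zero u -> biprod X u V ->
  idempotent_bound X n.+1 -> idempotent_bound V n.
Proof.
move=> u0 [i [p [j [q [pi1 qj pj qi _]]]]] bX I e ee e0 eo.
rewrite -ltnS -(card_option I).
have eE k l : j ** e k ** q ** (j ** e l ** q) = j ** (e k ** e l) ** q.
  by rewrite -!hcompA (hcompA q) qj hcomp1m.
apply: (bX _ (fun k => if k is Some l then j ** e l ** q else i ** p))
  => [[k|]|[k|]|[k|] [l|]]//.
- by rewrite eE ee.
- by rewrite -hcompA (hcompA p) pi1 hcomp1m.
- move=> iep; apply: (e0 k).
  transitivity (q ** (j ** e k ** q) ** j); last by rewrite iep hcompm0 hcomp0m.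
  by rewrite !hcompA qj hcomp1m -hcompA qj hcompm1.
- move=> ip; apply: u0; transitivity (p ** (i ** p) ** i).
    by rewrite hcompA pi1 hcomp1m pi1.
  by rewrite ip hcompm0 hcomp0m.
- by move=> kl; rewrite eE eo// hcompm0 hcomp0m.
- by rewrite -!hcompA (hcompA q) qi hcomp0m !hcompm0.
- by rewrite -!hcompA (hcompA p) pj hcomp0m !hcompm0.
Qed.

(** If X splits, the nonzero summand w1 lowers the bound for w2 by one. *)
Lemma indecomposable_retract X n : idempotent_bound X n -> ~ is_zero X ->
  exists2 u, indecomposable u & retract u X.
Proof.
elim: n X => [|n IH] X bX X0; first by case: X0; exact: idempotent_bound0.
have [indX|] := pselect (indecomposable X).
  by exists X => //; exists 1, 1; rewrite hcomp1m.
move=> /not_andP[/contrapT|/contrapT]; first by rewrite isometric_zero.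
move=> [w1 [w2 [w10 w20 /isometric_orthogonal_sum Xw]]].
rewrite !isometric_zero in w10 w20.
have [|u indu uw] := IH w2 _ w20.
  exact: idempotent_bound_biprod w10 Xw bX.
by exists u => //; exact: retract_trans uw (biprod_retract2 Xw).
Qed.

Lemma sumdec_exists X n : idempotent_bound X n ->
  exists (t : nat) (w : 'I_t -> pairing M),
    (forall i, indecomposable (w i)) /\ sumdec X w.
Proof.
elim: n X => [|n IH] X bX.
  exists 0, (fun=> X); split; first by case.
  exact: idempotent_bound0.
have [X0|X0] := pselect (is_zero X).
  by exists 0, (fun=> X); split; first by case.
have [u indu uX] := indecomposable_retract bX X0.
have [V XuV] := retract_biprod uX.
have [u0 _] := (indecomposableP u).1 indu.
have [t [w [indw Vw]]] := IH _ (idempotent_bound_biprod u0 XuV bX).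
exists t.+1, (fun i => if unlift ord0 i is Some i' then w i' else u).
split=> [i|]; first by case: unliftP.
exists V; first by rewrite unlift_none.
by under eq_fun => i do rewrite liftK.
Qed.

End KrullSchmidt.

(** * Fitting decompositions over finitely presented modules *)

Section AdditiveSpan.
Variable V : zmodType.
Implicit Types X : set V.

Lemma add_span0 X : add_span X 0.
Proof. by exists 0, (fun=> 0); split=> [[]//|]; rewrite big_ord0. Qed.

Lemma add_span_incl X x : X x -> add_span X x.
Proof. by move=> Xx; exists 1, (fun=> x); split=> //; rewrite big_ord1. Qed.

Lemma add_spanD X x y : add_span X x -> add_span X y -> add_span X (x + y).
Proof.
move=> [n [u [Xu ->]]] [m [v [Xv ->]]].
exists (n + m)%N, (fun i =>
  match fintype.split i with inl j => u j | inr k => v k end).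
split=> [i|]; first by case: (fintype.split i).
rewrite big_split_ord; congr (_ + _); apply: eq_bigr => i _.
  by rewrite (unsplitK (inl _ i)).
by rewrite (unsplitK (inr _ i)).
Qed.

Lemma add_span_ind X (Y : set V) :
  Y 0 -> (forall x y, Y x -> Y y -> Y (x + y)) ->
  X `<=` Y -> add_span X `<=` Y.
Proof.
by move=> Y0 YD XY v [n [x [Xx ->]]]; elim/big_ind: _ => // i _; exact/XY/Xx.
Qed.

End AdditiveSpan.

Definition submod (R : pzRingType) (A : lmodType R) (Y : set A) :=
  [/\ Y 0, forall x y, Y x -> Y y -> Y (x + y) & forall r x, Y x -> Y (r *: x)].

Section IdealMultiples.
Variables (R : pzRingType) (I : set R) (idI : two_sided_ideal I).

Lemma two_sided_idealD x y : I x -> I y -> I (x + y).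
Proof.
case: idI => I0 IB _ _ Ix Iy; rewrite -[y]opprK -[- y]sub0r.
by apply: (IB) => //; exact: IB.
Qed.

Lemma lideal_mul_submod (A : lmodType R) : submod (lideal_mul I A).
Proof.
split; [exact: add_span0 | exact: add_spanD |].
move=> r; apply: (@add_span_ind _ _ (fun x => lideal_mul I A (r *: x))).
- by rewrite scaler0; exact: add_span0.
- by move=> x y ? ?; rewrite scalerDr; exact: add_spanD.
- move=> _ [s Is [a _ <-]]; rewrite /= scalerA; apply: add_span_incl.
  by exists (r * s); [case: idI => _ _ + _; apply | exists a].
Qed.

Lemma lideal_mul_linear (A B : lmodType R) (f : {linear A -> B}) a :
  lideal_mul I A a -> lideal_mul I B (f a).
Proof.
apply: (@add_span_ind _ _ (fun a => lideal_mul I B (f a))).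
- by rewrite linear0; exact: add_span0.
- by move=> x y ? ?; rewrite linearD; exact: add_spanD.
- move=> _ [s Is [x _ <-]]; rewrite /= linearZ; apply: add_span_incl.
  by exists s => //; exists (f x).
Qed.

End IdealMultiples.

(* X^k and (1 - X)^l generate the unit ideal of Z[X]. *)
Lemma iter_compl_mem (R : pzRingType) (A : lmodType R) (f : {linear A -> A})
    (Y : set A) k l u : submod Y -> (forall a, Y a -> Y (f a)) ->
  Y (iter k f u) -> Y (iter l (fun a => a - f a) u) -> Y u.
Proof.
move=> [Y0 YD YZ] Yf; have YN a : Y a -> Y (- a).
  by rewrite -scaleN1r; exact: YZ.
(* The case k = 1: modulo Y the map f kills a, so all iterates of 1 - f at a agree with a. *)
have Yl a : Y (f a) -> Y (iter l (fun a => a - f a) a) -> Y a.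
  move=> Yfa; have Yfl l' : Y (f (iter l' (fun a => a - f a) a)).
    elim: l' => //= l' Yfl; rewrite linearB; apply: YD => //; exact/YN/Yf.
  elim: l => //= l IH Yb; apply: IH.
  by rewrite -[iter _ _ _](subrK (f (iter l (fun a => a - f a) a))); exact: YD.
elim: k u => // k IH u; rewrite iterSr => Yk Yfl; apply: (Yl) => //.
apply: IH => //; suff -> : iter l (fun a => a - f a) (f u) =
    f (iter l (fun a => a - f a) u) by exact: Yf.
by elim: l {Yl Yfl} => //= l ->; rewrite linearB.
Qed.

Section Fitting.

(* e is the Fitting idempotent of a and b the inverse of a on e; convergence to
   0 on 1 - e is expressed through the ideals in FI. *)
Definition matrix_fitting (R : pzRingType) (FI : set (set R)) :=
  forall n (a : 'M[R]_n), exists e b : 'M[R]_n,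
    [/\ e * e = e, a * b = e, b * a = e, e * b = b &
        forall I, FI I -> exists k, forall i j, I ((a ^+ k * (1 - e)) i j)].

Section RingFacts.
Variables (T : pzRingType) (a b e : T).
Hypotheses (ee : e * e = e) (ab : a * b = e) (ba : b * a = e) (eb : e * b = b).

Lemma fitting_comm : a * e = e * a.
Proof. by rewrite -{1}ba mulrA ab. Qed.

Lemma fitting_be : b * e = b.
Proof. by rewrite -ab mulrA ba. Qed.

(** a and b commute, so b^k a^k is a power of e; the extra factor [e] covers k = 0, where that power
    is 1. *)
Lemma fitting_expr k : b ^+ k * a ^+ k * e = e.
Proof.
have cab : GRing.comm b a by rewrite /GRing.comm ab ba.
rewrite -exprMn_comm// ba -exprSr.
by elim: k => // k IH; rewrite exprS IH.
Qed.

Lemma fitting_expr' k : e * (a ^+ k * b ^+ k) = e.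
Proof.
have cab : GRing.comm a b by rewrite /GRing.comm ab ba.
rewrite -exprMn_comm// ab -exprS.
by elim: k => // k IH; rewrite exprS IH.
Qed.

Lemma fitting_expr_compl k : (1 - e) * a ^+ k = a ^+ k * (1 - e).
Proof.
apply: commrX; rewrite /GRing.comm mulrBl mulrBr mul1r mulr1.
by rewrite fitting_comm.
Qed.

End RingFacts.

Variables (R : pzRingType) (FI : set (set R)).
Hypothesis FI_ideal : forall I, FI I -> two_sided_ideal I.
Hypothesis FI_sep : forall x, (forall I, FI I -> I x) -> x = 0.
Hypothesis fitR : matrix_fitting FI.

Lemma mulmx_ideal_l m n p I (A : 'M[R]_(m, n)) (B : 'M[R]_(n, p)) :
  FI I -> (forall i j, I (A i j)) -> forall i j, I ((A *m B) i j).
Proof.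
move=> FII IA i j; have [I0 _ _ Ir] := FI_ideal FII.
rewrite mxE; elim/big_ind: _ => //.
  by apply: two_sided_idealD; exact: FI_ideal.
by move=> k _; exact: Ir.
Qed.

Lemma mulmx_ideal_r m n p I (A : 'M[R]_(m, n)) (B : 'M[R]_(n, p)) :
  FI I -> (forall i j, I (B i j)) -> forall i j, I ((A *m B) i j).
Proof.
move=> FII IA i j; have [I0 _ Il _] := FI_ideal FII.
rewrite mxE; elim/big_ind: _ => //.
  by apply: two_sided_idealD; exact: FI_ideal.
by move=> k _; exact: Il.
Qed.

Lemma exprmx_intertwine m n (a : 'M[R]_n) (c : 'M[R]_m) (Q : 'M[R]_(m, n)) k :
  Q *m a = c *m Q -> Q *m a ^+ k = c ^+ k *m Q.
Proof.
move=> Qac; elim: k => [|k IH]; first by rewrite !expr0 mulmx1 mul1mx.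
by rewrite !exprSr -!mulmxE mulmxA IH -mulmxA Qac !mulmxA.
Qed.

(* Both off-diagonal corners of Q have entries in every I. *)
Lemma fitting_intertwine m n (a e b : 'M[R]_n) (c e' b' : 'M[R]_m)
    (Q : 'M[R]_(m, n)) :
  Q *m a = c *m Q ->
  [/\ e * e = e, a * b = e, b * a = e, e * b = b &
      forall I, FI I -> exists k, forall i j, I ((a ^+ k * (1 - e)) i j)] ->
  [/\ e' * e' = e', c * b' = e', b' * c = e', e' * b' = b' &
      forall I, FI I -> exists k, forall i j, I ((c ^+ k * (1 - e')) i j)] ->
  e' *m Q = Q *m e.
Proof.
move=> Qac [ee ab ba eb na] [ee' cb bc eb' nc].
have H1 : e' *m Q *m (1 - e) = 0.
  apply/matrixP => i j; rewrite [RHS]mxE; apply: FI_sep => I FII.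
  have [k Ik] := na _ FII.
  have cab : GRing.comm b' c by rewrite /GRing.comm bc cb.
  (* Expand e' as e' b'^k c^k and move c^k across Q, where it becomes a^k next to 1 - e. *)
  rewrite -(fitting_expr' ee' bc cb k) -!mulmxE -!mulmxA.
  rewrite (mulmxA (c ^+ k)) -(exprmx_intertwine k Qac) -!mulmxA.
  by do 3![apply: mulmx_ideal_r => // {}i {}j]; exact: Ik.
have H2 : (1 - e') *m Q *m e = 0.
  apply/matrixP => i j; rewrite [RHS]mxE; apply: FI_sep => I FII.
  have [k Ik] := nc _ FII.
  rewrite -(fitting_expr ee ba ab k) -!mulmxE !mulmxA.
  rewrite -(mulmxA _ Q) (exprmx_intertwine k Qac) !mulmxA.
  rewrite [_ *m c ^+ k](fitting_expr_compl cb bc).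
  by do 3![apply: mulmx_ideal_l => // {}i {}j]; exact: Ik.
move/eqP: H1; rewrite mulmxBr mulmx1 subr_eq0 => /eqP ->.
by move/eqP: H2; rewrite !mulmxBl mul1mx subr_eq0 => /eqP.
Qed.

Lemma lideal_mul_row (A : lmodType R) n (p : {linear 'rV[R]_n -> A}) I
    (v : 'rV[R]_n) :
  FI I -> (forall i j, I (v i j)) -> lideal_mul I A (p v).
Proof.
move=> FII Iv; rewrite (row_sum_delta v) linear_sum.
elim/big_ind: _ => [|x y|i _]; [exact: add_span0|exact: add_spanD|].
rewrite linearZ; apply: add_span_incl; exists (v 0 i) => //.
by exists (p (delta_mx 0 i)).
Qed.

(** f lifts to a matrix a on R^n and then to c on R^m. The presentation matrix intertwines the
    Fitting idempotents and inverses of a and c, so those of a descend to A. *)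
Lemma finitely_presented_fitting (A : lmodType R) (f : {linear A -> A}) :
  finitely_presented A ->
  exists e h : {linear A -> A},
    [/\ forall a, e (e a) = e a, forall a, f (h a) = e a,
        forall a, h (f a) = e a, forall a, e (h a) = h a &
        forall I, FI I -> exists k,
          forall a, lideal_mul I A (iter k f (a - e a))].
Proof.
move=> [n [m [p [q [p_surj pq]]]]].
have [s sK] : {s : A -> 'rV[R]_n & forall a, p (s a) = a}.
  apply: (@choice _ _ (fun a v => p v = a)) => a.
  by have [v _ <-] := p_surj a I; exists v.
have qM w : q w = w *m lin1_mx q by rewrite mul_rV_lin1.
have [a fpa] : exists a : 'M[R]_n, forall v, f (p v) = p (v *m a).
  exists (\matrix_i s (f (p (delta_mx 0 i)))) => v.
  rewrite {1}(row_sum_delta v) mulmx_sum_row !linear_sum.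
  by apply: eq_bigr => i _; rewrite !linearZ rowK sK.
have [c Qac] : exists c : 'M[R]_m, lin1_mx q *m a = c *m lin1_mx q.
  have [w qw] : {w : 'I_m -> 'rV[R]_m &
      forall j, q (w j) = q (delta_mx 0 j) *m a}.
    apply: (@choice _ _ (fun j w => q w = q (delta_mx 0 j) *m a)) => j.
    suff /pq[w ->] : p (q (delta_mx 0 j) *m a) = 0 by exists w.
    have /pq p0 : exists w, q (delta_mx 0 j) = q w by exists (delta_mx 0 j).
    by rewrite -fpa p0 linear0.
  exists (\matrix_j w j); apply/row_matrixP => j.
  by rewrite !row_mul rowK -qM qw rowE -qM.
have [e [b fit_a]] := fitR a; have [e' [b' fit_c]] := fitR c.
have Qe := fitting_intertwine Qac fit_a fit_c.
(* A matrix carrying relations to relations descends along p. The section s is only a map of sets;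
   [psK] is what makes the result linear. *)
have desc (x : 'M[R]_n) (y : 'M[R]_m) : y *m lin1_mx q = lin1_mx q *m x ->
    exists g : {linear A -> A}, forall v, g (p v) = p (v *m x).
  move=> yx; have psK u v : p u = p v -> p (u *m x) = p (v *m x).
    move=> uv; apply/subr0_eq; rewrite -linearB -mulmxBl.
    have /pq[w ->] : p (u - v) = 0 by rewrite linearB uv subrr.
    by apply/pq; exists (w *m y); rewrite !qM -!mulmxA yx.
  pose g a := p (s a *m x).
  have g_lin : linear g.
    move=> k u v; rewrite /g -linearZ -linearD scalemxAl -mulmxDl.
    by apply: psK; rewrite sK linearP !sK.
  pose G := GRing.isLinear.Build R A A *:%R g g_lin.
  pose g' : {linear A -> A} := HB.pack g G.
  by exists g' => v; apply: psK; rewrite sK.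
have [_ ab' cb' eb' _] := fit_c; have [ee ab ba eb na] := fit_a.
(* With Q the presentation matrix: b' Q = b' e' Q = b' Q e = b' Q a b = b' c Q b = e' Q b = Q e b =
   Q b. *)
have Qb : b' *m lin1_mx q = lin1_mx q *m b.
  have be' : b' *m e' = b' := fitting_be ab' cb' eb'.
  have ab_mx : a *m b = e := ab.
  rewrite -{1}be' -mulmxA Qe -{1}ab_mx (mulmxA _ a b) Qac -(mulmxA c) mulmxA.
  by rewrite [b' *m c]cb' mulmxA Qe -mulmxA [e *m b]eb.
have [eA eAE] := desc e e' Qe; have [hA hAE] := desc b b' Qb.
exists eA, hA.
have pind (P : A -> Prop) : (forall v, P (p v)) -> forall x, P x.
  by move=> Pp x; rewrite -(sK x).
split=> [||||I FII]; [apply: pind => v..|].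
- by rewrite !eAE -mulmxA [e *m e]ee.
- by rewrite hAE fpa eAE -mulmxA [b *m a]ba.
- by rewrite fpa hAE eAE -mulmxA [a *m b]ab.
- by rewrite hAE eAE -mulmxA [b *m e](fitting_be ab ba eb).
have [k Ik] := na I FII; exists k; apply: pind => v.
have iterE l u : iter l f (p u) = p (u *m a ^+ l).
  elim: l u => [|l IH] u; first by rewrite expr0 mulmx1.
  by rewrite iterSr fpa IH -mulmxA exprS.
rewrite eAE -linearB -{1}[v]mulmx1 -mulmxBr iterE -mulmxA.
apply: lideal_mul_row => // i j; apply: mulmx_ideal_r => // {}i {}j.
by rewrite [_ *m _](fitting_expr_compl ab ba).
Qed.

End Fitting.

(** * The exchange property for endomorphisms of a pairing *)

Section PairingExchange.
Variables (R S : pzRingType) (M : bimodType R S) (w : pairing M).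
Local Notation "f '**' g" := (hcomp f g) (at level 40, left associativity).
Local Notation A := (pairing_l w).
Local Notation B := (pairing_r w).
Variables (FR : set (set R)) (FS : set (set S^c)).
Hypothesis FR_ideal : forall I, FR I -> two_sided_ideal I.
Hypothesis FS_ideal : forall J, FS J -> two_sided_ideal J.
Hypothesis A_sep : forall a : A, (forall I, FR I -> lideal_mul I A a) -> a = 0.
Hypothesis B_sep : forall b : B, (forall J, FS J -> lideal_mul J B b) -> b = 0.
Hypothesis M_sepl :
  forall m : M, (forall I, FR I -> bimod_lideal_mul I M m) -> m = 0.
Hypothesis M_sepr :
  forall m : M, (forall J, FS J -> bimod_rideal_mul M J m) -> m = 0.

(** Module analogue of [matrix_fitting]; the exponent k is uniform in a. *)
Definition fitting_decomposition (T : pzRingType) (F : set (set T))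
    (C : lmodType T) (f e h : C -> C) :=
  [/\ forall a, e (e a) = e a, forall a, f (h a) = e a,
      forall a, h (f a) = e a, forall a, e (h a) = h a &
      forall I, F I -> exists k, forall a, lideal_mul I C (iter k f (a - e a))].

Lemma fitting_iter_surj (T : pzRingType) (F : set (set T)) (C : lmodType T)
    (f e h : C -> C) k a :
  fitting_decomposition F f e h -> exists a', iter k f a' = e a.
Proof.
move=> [ee fh hf eh _]; elim: k a => [|k IH] a; first by exists (e a).
by have [a' aE] := IH (h a); exists a'; rewrite iterS aE eh fh.
Qed.

Lemma hom_adj_iter (x : phom w w) k a b :
  w (iter k (homl x) a) b = w a (iter k (homr x) b).
Proof. by elim: k a b => //= k IH a b; rewrite hom_adj IH -iterSr. Qed.

Lemma pairing_lideal I a b : lideal_mul I A a -> bimod_lideal_mul I M (w a b).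
Proof.
apply: (@add_span_ind _ _ (fun a => bimod_lideal_mul I M (w a b))).
- by rewrite pairing0l; exact: add_span0.
- by move=> x y ? ?; rewrite pairingDl; exact: add_spanD.
move=> _ [r Ir [x _ <-]]; apply: add_span_incl; exists r => //.
exists (w x b) => //.
by rewrite -[b in RHS](scale1r (b : B)) pairingZ bimod_ract1.
Qed.

Lemma pairing_rideal J a b : lideal_mul J B b -> bimod_rideal_mul M J (w a b).
Proof.
apply: (@add_span_ind _ _ (fun b => bimod_rideal_mul M J (w a b))).
- by rewrite pairing0r; exact: add_span0.
- by move=> x y ? ?; rewrite pairingDr; exact: add_spanD.
move=> _ [s Js [x _ <-]]; apply: add_span_incl.
exists (w a x) => //; exists s => //.
by rewrite -[a in RHS]scale1r pairingZ scale1r.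
Qed.

(** Right components compose in reverse, so there the condition concerns f x^k and not x^k f. Hence
    multiplying f on either side calls for a factor commuting with x. *)
Definition nilpotent_on (x f : phom w w) :=
  (forall I, FR I -> exists k, forall a,
     lideal_mul I A (iter k (homl x) (homl f a))) /\
  (forall J, FS J -> exists k, forall b,
     lideal_mul J B (iter k (homr x) (homr f b))).

Lemma pairing_fitting (x : phom w w) (eA hA : {linear A -> A})
    (eB hB : {linear B -> B}) :
  fitting_decomposition FR (homl x) eA hA ->
  fitting_decomposition FS (homr x) eB hB ->
  exists e y : phom w w,
    [/\ e ** e = e, x ** y = e, y ** x = e & nilpotent_on x (idhom w - e)].
Proof.
move=> fA fB; have [eeA fhA hfA ehA nA] := fA; have [eeB fhB hfB ehB nB] := fB.
have e_r a b : w (eA a) (b - eB b) = 0.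
  apply: M_sepr => J FJ; have [k Jk] := nB J FJ.
  (* Write eA a as x^k a' and move x^k to the other argument, where it sends b - eB b into J B. *)
  have [a' <-] := fitting_iter_surj k a fA.
  by rewrite hom_adj_iter; exact: pairing_rideal.
have e_l a b : w (a - eA a) (eB b) = 0.
  apply: M_sepl => I FI; have [k Ik] := nA I FI.
  have [b' <-] := fitting_iter_surj k b fB.
  by rewrite -hom_adj_iter; exact: pairing_lideal.
have e_adj a b : w (eA a) b = w a (eB b).
  transitivity (w (eA a) (eB b)).
    by apply/subr0_eq; rewrite -pairingNr -pairingDr e_r.
  by apply/esym/subr0_eq; rewrite -pairingNl -pairingDl e_l.
have @e : phom w w.
  by exists eA eB => //; exact: linearP.
have @y : phom w w.
  exists hA hB; [exact: linearP | exact: linearP|] => a b.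
  by rewrite -ehA e_adj -fhB -hom_adj fhA e_adj ehB.
by exists e, y; split; [exact: hom_eq..|]; split.
Qed.

(** By [iter_compl_mem] the values of f e lie in every I A, respectively every J B, hence vanish. *)
Lemma nilpotent_on_compl (x f e : phom w w) :
  nilpotent_on x (f ** e) -> nilpotent_on (idhom w - x) (f ** e) -> f ** e = 0.
Proof.
move=> [xA xB] [xA' xB']; apply: hom_eq => a.
  apply: A_sep => I FI; have [k Ik] := xA I FI; have [l Il] := xA' I FI.
  apply: (@iter_compl_mem _ _ (homl x) _ k l) => //.
    exact/lideal_mul_submod/FR_ideal.
  exact: lideal_mul_linear.
apply: B_sep => I FI; have [k Ik] := xB I FI; have [l Il] := xB' I FI.
apply: (@iter_compl_mem _ _ (homr x) _ k l) => //.
  exact/lideal_mul_submod/FS_ideal.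
exact: lideal_mul_linear.
Qed.

Lemma iter_homC (x f : phom w w) k : x ** f = f ** x ->
  (forall a, iter k (homl x) (homl f a) = homl f (iter k (homl x) a)) /\
  (forall b, iter k (homr x) (homr f b) = homr f (iter k (homr x) b)).
Proof.
move=> xf; split=> a; elim: k => //= k ->.
  by rewrite -[LHS]/(homl (x ** f) _) xf.
by rewrite -[LHS]/(homr (f ** x) _) -xf.
Qed.

Lemma nilpotent_onMl (x f g : phom w w) : x ** g = g ** x ->
  nilpotent_on x f -> nilpotent_on x (g ** f).
Proof.
move=> xg [fA fB]; split=> I FI.
  have [k Ik] := fA I FI; exists k => a.
  by rewrite (iter_homC k xg).1; exact: lideal_mul_linear.
by have [k Ik] := fB I FI; exists k => b; exact: Ik.
Qed.

Lemma nilpotent_onMr (x f g : phom w w) : x ** g = g ** x ->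
  nilpotent_on x f -> nilpotent_on x (f ** g).
Proof.
move=> xg [fA fB]; split=> I FI.
  by have [k Ik] := fA I FI; exists k => b; exact: Ik.
have [k Ik] := fB I FI; exists k => a.
by rewrite (iter_homC k xg).2; exact: lideal_mul_linear.
Qed.

Hypothesis A_fitting : forall f : {linear A -> A}, exists e h : {linear A -> A},
  fitting_decomposition FR f e h.
Hypothesis B_fitting : forall f : {linear B -> B}, exists e h : {linear B -> B},
  fitting_decomposition FS f e h.

(* With e and e' the Fitting idempotents of x and 1 - x, both x and 1 - x are
   topologically nilpotent on (1 - e')(1 - e), which therefore vanishes. *)
Lemma fitting_exchange : exchange w.
Proof.
have fit (x : phom w w) : exists e y : phom w w,
    [/\ e ** e = e, x ** y = e, y ** x = e & nilpotent_on x (idhom w - e)].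
  have [eA [hA fA]] := A_fitting (homl x).
  have [eB [hB fB]] := B_fitting (homr x).
  exact: pairing_fitting fA fB.
move=> x; have [e [y [ee xy yx ne]]] := fit x.
have [e' [y' [_ xy' yx' ne']]] := fit (idhom w - x).
(* For this z, (1 - x) z = e' (1 - e), so the condition becomes (1 - e') (1 - e) = 0. *)
exists e, y, (y' ** (idhom w - e)); split=> //.
rewrite hcompA xy'; apply/subr0_eq.
rewrite -[X in X - _]hcomp1m -hcompBl.
have xe : x ** e = e ** x by rewrite -{1}yx -xy !hcompA.
have xe' : x ** e' = e' ** x.
  have : (idhom w - x) ** e' = e' ** (idhom w - x).
    by rewrite -{1}yx' -xy' !hcompA.
  by rewrite hcompBl hcompBr hcomp1m hcompm1 => /addrI/oppr_inj.
have cC (z f : phom w w) : z ** f = f ** z ->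
    z ** (idhom w - f) = (idhom w - f) ** z.
  by move=> zf; rewrite hcompBl hcompBr hcomp1m hcompm1 zf.
apply: (@nilpotent_on_compl x).
  by apply: nilpotent_onMl => //; exact: cC.
apply: nilpotent_onMr => //; apply: (cC); apply/esym; apply: cC.
by rewrite xe.
Qed.

End PairingExchange.

(** * A bound on orthogonal idempotents *)

Section HollowDimension.
Variables (R : pzRingType) (A : lmodType R).
Implicit Types (s : seq A) (Y X : set A).

Fixpoint lspan s : set A :=
  if s is x :: s' then [set v | exists r, lspan s' (v - r *: x)] else [set 0].

Lemma submodN Y a : submod Y -> Y a -> Y (- a).
Proof. by move=> [_ _ YZ] Ya; rewrite -scaleN1r; exact: YZ. Qed.

Lemma submodB Y a b : submod Y -> Y a -> Y b -> Y (a - b).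
Proof.
by move=> sY Ya Yb; have [_ YD _] := sY; apply: YD => //; exact: submodN.
Qed.

Lemma submod_eq Y a b : submod Y -> Y (a - b) -> Y a <-> Y b.
Proof.
move=> sY Yab; have [_ YD _] := sY; split=> [Ya|Yb].
  by rewrite -[b](subKr a); exact: submodB.
by rewrite -[a](subrK b); exact: YD.
Qed.

Lemma lspan_submod s : submod (lspan s).
Proof.
elim: s => [|x s [s0 sD sZ]]; split=> /=; rewrite ?add0r//.
- by move=> ? ? -> ->; rewrite addr0.
- by move=> r ? ->; rewrite scaler0.
- by exists 0; rewrite scale0r subr0.
- move=> u v [r ru] [r' rv]; exists (r + r').
  by rewrite scalerDl opprD addrACA; exact: sD.
- by move=> r u [r' ru]; exists (r * r'); rewrite -scalerA -scalerBr; exact: sZ.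
Qed.

Lemma lspan_sub s Y : submod Y -> (forall x, x \in s -> Y x) -> lspan s `<=` Y.
Proof.
move=> sY; have [Y0 YD YZ] := sY.
elim: s => [_ v ->//|x s IH] sub_sY v [r] /IH Yv.
rewrite -[v](subrK (r *: x)); apply: YD.
  by apply: Yv => y ys; apply: sub_sY; rewrite inE ys orbT.
by apply/YZ/sub_sY; rewrite mem_head.
Qed.

Lemma mem_lspan s x : x \in s -> lspan s x.
Proof.
elim: s => //= y s IH; rewrite inE => /predU1P[->|/IH xs].
  by exists 1; rewrite scale1r subrr; case: (lspan_submod s).
by exists 0; rewrite scale0r subr0.
Qed.

(* An idempotent e whose corner eRe is local, in the form needed for modules:
   for t in eRe, one of t and e - t is left invertible. *)
Definition left_local (e : R) := e * e = e /\
  forall t, (exists u, u * (e * t * e) = e) \/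
            (exists u, u * (e - e * t * e) = e).

(** R x is then an image of R e, hence zero or a local module. *)
Definition local_elt (x : A) := exists2 e, left_local e & e *: x = x.

Definition maximal_submod X := [/\ submod X, exists a, ~ X a &
  forall y, ~ X y -> forall x, exists r, X (x - r *: y)].

(** The intersection of X with the local module R x is its only maximal submodule, so it lies in
    every maximal X'. *)
Lemma local_elt_maximal X X' x r : local_elt x ->
  maximal_submod X -> maximal_submod X' -> ~ X x -> X (r *: x) -> X' (r *: x).
Proof.
move=> [e [ee loc] ex] [sX _ _] [sX' _ maxX'] Xx Xrx.
have [_ _ XZ] := sX; have [_ _ X'Z] := sX'.
apply: contrapT => X'rx; have [s Xs] := maxX' _ X'rx x.
case: (loc (s * r)) => -[u ue].
  have xE : x = u *: (e *: (s *: (r *: x))).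
    by rewrite -{1}ex -{1}ue -!scalerA ex.
  by apply: Xx; rewrite xE; do 3!apply: (XZ).
have xE : x = u *: (e *: (x - s *: (r *: x))).
  by rewrite scalerBr -{1}ex -{1}ue -!scalerA scalerBl -!scalerA !ex.
by apply/X'rx/X'Z; rewrite xE; do 2!apply: (X'Z).
Qed.

(** Each x = e x becomes e (x - r x0) with x - r x0 in X. The factor e keeps it local, and x is
    recovered up to a multiple of x0. *)
Lemma lspan_shift s x0 X : ~ X x0 -> maximal_submod X ->
  (forall x, x \in s -> local_elt x) ->
  exists s', [/\ size s' = size s, forall x, x \in s' -> local_elt x /\ X x &
    forall v, lspan s v -> exists r, lspan s' (v - r *: x0)].
Proof.
move=> Xx0 maxX; elim: s => [_|x s IH locs].
  by exists [::]; split=> // v ->; exists 0; rewrite scale0r subrr.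
have [|s' [size_s' locs' span_s']] := IH.
  by move=> y ys; apply: locs; rewrite inE ys orbT.
have [e eloc ex] := locs x (mem_head _ _).
have [sX _ maxXX] := maxX; have [_ _ XZ] := sX.
have [r Xr] := maxXX _ Xx0 x.
exists (e *: (x - r *: x0) :: s'); split=> /= [|y|v [c vc]].
- by rewrite size_s'.
- rewrite inE => /predU1P[->|/locs'//]; split; last exact: XZ.
  by exists e => //; rewrite scalerA; case: eloc => ->.
have [d vd] := span_s' _ vc; exists (d + c * e * r), c.
rewrite [e *: _]scalerBr ex scalerDl [c *: _]scalerBr !scalerA.
by rewrite opprB opprD !addrA subrK addrAC.
Qed.

(* The last hypothesis says that the X i are coindependent. Some generator x0 is
   outside X i0; shifting the other generators into X i0 along x0 disposes of
   x0 and i0 together. *)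
Lemma coindependent_bound (I : finType) (P : {set I}) (X : I -> set A) s :
  (forall i, i \in P -> maximal_submod (X i)) ->
  (forall x, x \in s -> local_elt x) ->
  (forall a : I -> A,
     exists2 v, lspan s v & forall i, i \in P -> X i (v - a i)) ->
  (#|P| <= size s)%N.
Proof.
move: {2}(size s) (erefl (size s)) => n.
elim: n s P => [|n IH] s P sn maxX locs surj.
all: have [->|[i0 i0P]] := set_0Vmem P; first by rewrite cards0.
all: have [sX [a Xa] _] := maxX _ i0P; have [X0 _ _] := sX.
all: have [v sv /(_ _ i0P) Xv] := surj (fun=> a).
all: have {Xv} Xv : ~ X i0 v by move/(submod_eq sX Xv).
  by case: Xv; move: sv; rewrite (size0nil sn) => ->.
have [x0 x0s Xx0] : exists2 x0, x0 \in s & ~ X i0 x0.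
  apply: contrapT => H; apply: Xv; apply: (lspan_sub sX) sv => x xs.
  by apply: contrapT => Xx; apply: H; exists x.
have locs1 x : x \in rem x0 s -> local_elt x by move=> /mem_rem/locs.
have [s' [size_s' locs' span_s']] := lspan_shift Xx0 (maxX _ i0P) locs1.
have size_s'n : size s' = n by rewrite size_s' size_rem// sn.
rewrite sn (cardsD1 i0) i0P ltnS -size_s'n; apply: IH => //.
- by move=> i /setD1P[_ /maxX].
- by move=> x /locs'[].
(* Prescribing 0 at i0 forces r x0 into X i0, hence into every X i, so subtracting it from u
   preserves the congruences. *)
move=> b; have [u su ub] := surj (fun i => if i == i0 then 0 else b i).
have [r us'] : exists r, lspan s' (u - r *: x0).
  have [r1 /span_s'[r2]] : lspan (x0 :: rem x0 s) u.
    apply: lspan_sub su; first exact: lspan_submod.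
    by move=> x xs; apply: mem_lspan; rewrite -(perm_mem (perm_to_rem x0s)).
  by exists (r1 + r2); rewrite scalerDl opprD addrA.
exists (u - r *: x0) => // i /setD1P[ii0 iP].
have Xr0 : X i0 (r *: x0).
  have Xu : X i0 u by have := ub _ i0P; rewrite eqxx subr0.
  rewrite -[r *: x0](subKr u); apply: (submodB sX) Xu _.
  by apply: (lspan_sub sX) us' => x /locs'[].
have Xr := local_elt_maximal (locs _ x0s) (maxX _ i0P) (maxX _ iP) Xx0 Xr0.
have [sXi _ _] := maxX _ iP; rewrite addrAC; apply: submodB => //.
by have := ub _ iP; rewrite (negbTE ii0).
Qed.

(** Adjoin generators to Y until the sum is A: Z is the last proper sum and x the generator that
    completes it. *)
Lemma local_elt_above s Y : (forall x, x \in s -> local_elt x) ->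
  (forall a, exists2 y, Y y & lspan s (a - y)) ->
  submod Y -> (exists a, ~ Y a) ->
  exists Z x, [/\ submod Z, Y `<=` Z, ~ Z x, local_elt x &
                  forall a, exists r, Z (a - r *: x)].
Proof.
elim: s Y => [|x s IH] Y locs YT sY [a0 Ya0].
  by have [y Yy /subr0_eq a0y] := YT a0; case: Ya0; rewrite a0y.
have [Y0 YD YZ] := sY.
pose Y' : set A := [set a | exists r, Y (a - r *: x)].
have YY' : Y `<=` Y' by move=> a Ya; exists 0; rewrite scale0r subr0.
have sY' : submod Y'.
  split=> [|u v [r ru] [r' rv]|r u [r' ru]]; first exact: YY'.
    by exists (r + r'); rewrite scalerDl opprD addrACA; exact: YD.
  by exists (r * r'); rewrite -scalerA -scalerBr; exact: YZ.
have [Y'T|/existsNP Y'T] := pselect (forall a, Y' a).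
  exists Y, x; split=> // [Yx|]; last exact: locs (mem_head _ _).
  have [r Yr] := Y'T a0; apply/Ya0/(submod_eq sY Yr).
  exact: YZ.
have [||Z [z [sZ Y'Z Zz locz zT]]] := IH Y' _ _ sY' Y'T.
- by move=> y ys; apply: locs; rewrite inE ys orbT.
- move=> a; have [y Yy [r syr]] := YT a; exists (y + r *: x).
    by exists r; rewrite addrK.
  by rewrite opprD addrA.
- by exists Z, z; split=> //; exact: subset_trans Y'Z.
Qed.

(** With Z and x from [local_elt_above], A / Z is a local module generated by x; its maximal
    submodule consists of the elements that do not generate it. *)
Lemma maximal_submod_exists s Y : (forall x, x \in s -> local_elt x) ->
  lspan s = setT -> submod Y -> (exists a, ~ Y a) ->
  exists2 X, maximal_submod X & Y `<=` X.
Proof.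
move=> locs spanT sY Yproper.
have [a|Z [x [sZ YZ Zx [e [ee loc] ex] xT]]] :=
  local_elt_above locs _ sY Yproper.
  by exists 0; [case: sY | rewrite spanT].
have [Z0 ZD ZZ] := sZ.
pose X : set A := [set y | forall r, ~ Z (x - r *: y)].
have ZX : Z `<=` X.
  move=> y Zy r Zr; apply: Zx; rewrite -[x](subrK (r *: y)).
  by apply: ZD => //; exact: ZZ.
exists X; last exact: subset_trans ZX.
split; [split|by exists x => /(_ 1); rewrite scale1r subrr|].
- exact: ZX.
- move=> y1 y2 Xy1 Xy2 r Zr.
  have [s1 Zs1] := xT (r *: y1); have [s2 Zs2] := xT (r *: y2).
  (* Modulo Z, x = s1 x + s2 x. If e s1 e is left invertible then y1 generates x; otherwise e - e s1
     e is, and y2 does. *)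
  have Zs : Z (x - s1 *: x - s2 *: x).
    have -> : x - s1 *: x - s2 *: x = (x - r *: (y1 + y2)) +
        ((r *: y1 - s1 *: x) + (r *: y2 - s2 *: x)).
      by rewrite scalerDr [X in _ = _ + X]addrACA [RHS]addrA subrK addrA.
    by apply: (ZD) => //; exact: ZD.
  case: (loc s1) => -[u ue].
    have xE : x = u *: (e *: (s1 *: x)) by rewrite -{1}ex -{1}ue -!scalerA ex.
    apply: (Xy1 (u * e * r)); rewrite {1}xE -!scalerA -!scalerBr.
    by do 2!apply: (ZZ); rewrite -opprB; exact: submodN.
  have xE : x = u *: (e *: (x - s1 *: x)).
    by rewrite scalerBr -{1}ex -{1}ue -!scalerA scalerBl -!scalerA !ex.
  apply: (Xy2 (u * e * r)); rewrite {1}xE -!scalerA -!scalerBr.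
  do 2!apply: (ZZ); rewrite -[x - s1 *: x](subrK (s2 *: x)) -addrA.
  by apply: ZD => //; rewrite -opprB; exact: submodN.
- by move=> r y Xy r'; rewrite scalerA; exact: Xy.
move=> y /existsNP[r /contrapT Zr] z; have [t Zt] := xT z.
exists (t * r); apply: ZX.
rewrite -scalerA -[z](subrK (t *: x)) -addrA -scalerBr.
by apply: ZD => //; exact: ZZ.
Qed.

(* Each nonzero e i yields a maximal submodule containing the kernel of e i. *)
Lemma orthogonal_idempotents_bound (I : finType) (e : I -> {linear A -> A}) s :
  (forall x, x \in s -> local_elt x) -> lspan s = setT ->
  (forall i a, e i (e i a) = e i a) ->
  (forall i j a, i != j -> e i (e j a) = 0) ->
  (#|finset (fun i => `[< exists a, e i a <> 0%R >])| <= size s)%N.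
Proof.
move=> locs spanT ee eo; set P := finset _.
have maxX i : exists X,
    i \in P -> maximal_submod X /\ forall a, e i a = 0 -> X a.
  have [|] := boolP (i \in P); last by exists setT.
  rewrite inE => /asboolP[a ea]; have [| |X maxX kerX] :=
    @maximal_submod_exists s (fun a => e i a = 0) locs spanT.
  - split=> [|x y ex ey|r x ex]; first exact: linear0.
      by rewrite linearD ex ey addr0.
    by rewrite linearZ /= ex scaler0.
  - by exists a.
  - by exists X => _; split.
have [X XP] := choice maxX.
apply: (@coindependent_bound I P X s _ locs) => [i /XP[]//|a].
(* By orthogonality this sum and a i have the same image under e i, so they differ by an element of
   the kernel. *)
exists (\sum_i e i (a i)); first by rewrite spanT.
move=> i iP; have [_ kerX] := XP i iP; apply: kerX.
rewrite linearB linear_sum (bigD1 i)//= big1 ?addr0 ?ee ?subrr// => j ji.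
by rewrite eo// eq_sym.
Qed.

End HollowDimension.

(** * Semiperfect and linearly topologized rings *)

Definition left_semiperfect (R : pzRingType) :=
  exists (t : nat) (e : 'I_t -> R),
    \sum_(i < t) e i = 1 /\ forall i, left_local (e i).

(** The two elements add up to e, the identity of the corner. *)
Lemma corner_local_invertible (R : pzRingType) (e t : R) : e * e = e ->
  corner_local e ->
  corner_invertible e (e * t * e) \/ corner_invertible e (e - e * t * e).
Proof.
move=> ee [e0 H]; apply: contrapT => /not_orP[n1 n2].
have c1 : corner e (e * t * e) by exists t.
have c2 : corner e (e - e * t * e).
  by exists (1 - t) => //; rewrite mulrBr mulr1 mulrBl ee.
apply: (H _ _ c1 c2 n1 n2); rewrite addrC subrK.
by exists e; [exists 1 => //; rewrite mulr1|].
Qed.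

Lemma semiperfect_left (R : pzRingType) : semiperfect R -> left_semiperfect R.
Proof.
move=> [t [e [ee _ e1 eloc]]]; exists t, e; split=> // i; split=> [|x].
  exact: ee.
by case: (corner_local_invertible x (ee i) (eloc i)) => -[y _ [_ ye]];
  [left|right]; exists y.
Qed.

(** Corner inverses are two-sided, and a right inverse in S is a left inverse in S^c. *)
Lemma semiperfect_right (S : pzRingType) :
  semiperfect S -> left_semiperfect S^c.
Proof.
move=> [t [e [ee _ e1 eloc]]]; exists t, e; split=> // i; split=> [|x].
  exact: ee.
have xE : ((e i : S^c) * x * (e i : S^c) : S^c) = (e i * (x : S) * e i : S).
  exact/esym/mulrA.
rewrite xE; case: (@corner_local_invertible S (e i) x (ee i) (eloc i)).
  by move=> [y _ [ey _]]; left; exists y.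
by move=> [y _ [ey _]]; right; exists y.
Qed.

(** As 1 is the sum of the e i, multiplying generators by all the e i gives generators again. *)
Lemma local_generators (R : pzRingType) (A : lmodType R) :
  left_semiperfect R -> finitely_presented A ->
  exists s : seq A, (forall x, x \in s -> local_elt x) /\ lspan s = setT.
Proof.
move=> [t [e [e1 eloc]]] [n [_ [p [_ [p_surj _]]]]].
exists [seq e i *: p (delta_mx 0 j) | i <- enum 'I_t, j <- enum 'I_n].
split=> [x /allpairsP[[i j] /= [_ _ ->]]|].
  by exists (e i) => //; rewrite scalerA; case: (eloc i) => ->.
apply/seteqP; split=> // a _; have [v _ <-] := p_surj a I.
have [s0 sD sZ] := lspan_submod
  [seq e i *: p (delta_mx 0 j) | i <- enum 'I_t, j <- enum 'I_n].
rewrite (row_sum_delta v) linear_sum; elim/big_ind: _ => // j _.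
rewrite linearZ -[p _]scale1r -e1 scaler_suml; apply: sZ.
elim/big_ind: _ => // i _; apply: mem_lspan; apply/allpairsP.
by exists (i, j); rewrite !mem_enum.
Qed.

(** Transposition is an anti-isomorphism from matrices over S to matrices over S^c. *)
Lemma matrix_fitting_converse (S : pzRingType) (F : set (set S)) :
  matrix_fitting F -> @matrix_fitting S^c F.
Proof.
move=> fitS n a; have [e [b [ee ab ba eb na]]] := fitS n (a^T : 'M[S]_n).
have trM (x y : 'M[S]_n) : (x * y)^T = (y^T : 'M[S^c]_n) * (x^T : 'M[S^c]_n).
  exact: trmx_mul_rev.
have trX k : (((a^T : 'M[S]_n) ^+ k)^T : 'M[S^c]_n) = a ^+ k.
  elim: k => [|k IH]; first by rewrite !expr0 trmx1.
  by rewrite exprS trM IH trmxK exprSr.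
exists (e^T : 'M[S^c]_n), (b^T : 'M[S^c]_n).
have ee' : (e^T : 'M[S^c]_n) * e^T = e^T by rewrite -trM ee.
have ab' : a * (b^T : 'M[S^c]_n) = e^T by rewrite -{1}[a]trmxK -trM ba.
have ba' : (b^T : 'M[S^c]_n) * a = e^T by rewrite -{1}[a]trmxK -trM ab.
have be := fitting_be ab ba eb.
split=> //; first by rewrite -trM be.
move=> I FI; have [k Ik] := na I FI; exists k => i j.
rewrite -(fitting_expr_compl ab' ba') -trX.
have -> : 1 - (e^T : 'M[S^c]_n) = ((1 - e)^T : 'M[S^c]_n).
  by apply/matrixP => u v; rewrite !mxE eq_sym.
by rewrite -trM mxE.
Qed.

(** The off-diagonal corners of a vanish, so e a = a e = e a e and the corner inverse y inverts a on
    e. *)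
Lemma corner_fitting (T : pzRingType) (a e : T) : e * e = e ->
  a = e * a * e + (1 - e) * a * (1 - e) -> corner_invertible e (e * a * e) ->
  exists y, [/\ e * e = e, a * y = e, y * a = e & e * y = y].
Proof.
move=> ee aE [y [x _ yx] [ey ye]].
have ea : e * a = e * a * e.
  rewrite {1}aE mulrDr !mulrA ee [e * (1 - e)]mulrBr mulr1 ee subrr.
  by rewrite !mul0r addr0.
have ae : a * e = e * a * e.
  rewrite {1}aE mulrDl -!mulrA ee [(1 - e) * e]mulrBl mul1r ee subrr.
  by rewrite !mulr0 addr0.
have ey1 : e * y = y by rewrite -yx !mulrA ee.
have ye1 : y * e = y by rewrite -yx -!mulrA ee.
exists y; split=> //; first by rewrite -ey1 mulrA ae.
by rewrite -ye1 -mulrA ea.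
Qed.

Lemma corner_fitting_expr (T : pzRingType) (a e y : T) k : e * e = e ->
  a * y = e -> y * a = e -> (1 - e) * a ^+ k * (1 - e) = a ^+ k * (1 - e).
Proof.
move=> ee ay ya; rewrite (fitting_expr_compl ay ya) -mulrA.
by rewrite mulrBl mul1r [e * (1 - e)]mulrBr mulr1 ee subrr subr0.
Qed.

Section Topology.
Variable R : topologicalPzRingType.

(** Neighborhoods of 0 rather than open sets: the form in which [linearly_topologized] supplies
    ideals. *)
Definition nbhs_ideals : set (set R) := [set I | nbhs 0 I /\ two_sided_ideal I].

Lemma open_nbhs_ideals : @open_ideals R `<=` nbhs_ideals.
Proof.
move=> I [openI idI]; split=> //; apply: open_nbhs_nbhs; split=> //.
by case: idI.
Qed.

Lemma nbhs_ideals_sep (x : R) : linearly_topologized R -> hausdorff_space R ->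
  (forall I, nbhs_ideals I -> I x) -> x = 0.
Proof.
move=> ltR haus idx; apply: haus => U V Ux V0.
have [I [I0 idI] IV] := ltR V V0.
exists x; split; first exact: nbhs_singleton Ux.
exact: IV (idx I (conj I0 idI)).
Qed.

Lemma fitting_property_matrix : linearly_topologized R -> fitting_property R ->
  matrix_fitting nbhs_ideals.
Proof.
move=> ltR [_ fitR] [|n] a.
  (* Size 0 is outside [fitting_property] but occurs in presentations, for instance without
     relations. *)
  exists 0, 0; split; try by apply/matrixP => -[].
  by move=> I _; exists 0 => -[].
have [e [ee aE einv lim0]] := fitR n.+1 isT a.
have [y [eK ay ya ey]] := corner_fitting ee aE einv.
exists e, y; split=> // I [I0 idI].
have NI : nbhs (0 : 'M[R]_n.+1) [set B | forall i j, I (B i j)].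
  by exists (fun _ _ => I) => // i j; rewrite mxE.
have [k _ Ik] := lim0 _ NI; exists k => i j.
have -> : a ^+ k * (1 - e) = (1 - e) * a ^+ k * (1 - e).
  by rewrite (corner_fitting_expr k ee ay ya).
exact: Ik (leqnn k) i j.
Qed.

Lemma hausdorff_lmod_sep (A : lmodType R) (a : A) : hausdorff_lmod A ->
  (forall I, nbhs_ideals I -> lideal_mul I A a) -> a = 0.
Proof.
move=> hA Ia; have : [set 0] a by rewrite -hA => I /open_nbhs_ideals/Ia.
by [].
Qed.

End Topology.

Lemma two_sided_ideal_converse (S : pzRingType) (J : set S) :
  two_sided_ideal J -> @two_sided_ideal S^c J.
Proof.
by move=> [J0 JB Jl Jr]; split=> //; move=> x y ?; [apply: Jr|apply: Jl].
Qed.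

(** A nonzero e i acts nontrivially on A or on B, so the bounds for the two modules add up. *)
Lemma idempotent_bound_exists (R S : pzRingType) (M : bimodType R S)
    (w : pairing M) (s : seq (pairing_l w)) (s' : seq (pairing_r w)) :
  (forall x, x \in s -> local_elt x) -> lspan s = setT ->
  (forall x, x \in s' -> local_elt x) -> lspan s' = setT ->
  idempotent_bound w (size s + size s').
Proof.
move=> locs spans locs' spans' I e ee e0 eo.
have eeA i a : homl (e i) (homl (e i) a) = homl (e i) a.
  by rewrite -[LHS]/(homl (hcomp (e i) (e i)) a) ee.
have eeB i b : homr (e i) (homr (e i) b) = homr (e i) b.
  by rewrite -[LHS]/(homr (hcomp (e i) (e i)) b) ee.
have eoA i j a : i != j -> homl (e i) (homl (e j) a) = 0.
  by move=> ij; rewrite -[LHS]/(homl (hcomp (e i) (e j)) a) eo.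
have eoB i j b : i != j -> homr (e i) (homr (e j) b) = 0.
  by move=> ij; rewrite -[LHS]/(homr (hcomp (e j) (e i)) b) eo// eq_sym.
have bA := orthogonal_idempotents_bound (e := fun i => homl (e i))
  locs spans eeA eoA.
have bB := orthogonal_idempotents_bound (e := fun i => homr (e i))
  locs' spans' eeB eoB.
apply: leq_trans (leq_add bA bB); apply: leq_trans (leq_card_setU _ _).
rewrite -cardsT; apply/subset_leq_card/fintype.subsetP => i _; rewrite !inE.
apply: contrapT => /negP; rewrite negb_or => /andP[/asboolPn eA /asboolPn eB].
apply: (e0 i); apply: hom_eq => x; apply: contrapT => ex.
  by apply: eA; exists x.
by apply: eB; exists x.
Qed.

Theorem corollary6p9 (R S : topologicalPzRingType) (M : bimodType R S) :
  semiperfect R -> linearly_topologized R -> fitting_property R ->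
  semiperfect S -> linearly_topologized S -> fitting_property S ->
  hausdorff_bimod M ->
  forall omega : pairing M,
    hausdorff_lmod (pairing_l omega) -> finitely_presented (pairing_l omega) ->
    hausdorff_rmod (pairing_r omega) -> finitely_presented (pairing_r omega) ->
    (exists (t : nat) (w : 'I_t -> pairing M),
       (forall i, indecomposable (w i)) /\
       isometric omega (orthogonal_sums w)) /\
    (forall (t t' : nat) (w : 'I_t -> pairing M) (w' : 'I_t' -> pairing M),
       (forall i, indecomposable (w i)) ->
       isometric omega (orthogonal_sums w) ->
       (forall i, indecomposable (w' i)) ->
       isometric omega (orthogonal_sums w') ->
       t = t' /\
       exists sigma : 'I_t -> 'I_t', bijective sigma /\
         forall i, isometric (w i) (w' (sigma i))).
Proof.
move=> spR ltR fpR spS ltS fpS hM w hA fA hB fB.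
pose FS : set (set S^c) := @nbhs_ideals S.
have FR_ideal I : @nbhs_ideals R I -> two_sided_ideal I by case.
have FS_ideal J : FS J -> two_sided_ideal J.
  by move=> [_]; exact: two_sided_ideal_converse.
have FR_sep x : (forall I, @nbhs_ideals R I -> I x) -> x = 0.
  by apply: nbhs_ideals_sep => //; case: fpR.
have FS_sep (x : S^c) : (forall J, FS J -> J x) -> x = 0.
  by apply: (@nbhs_ideals_sep S) => //; case: fpS.
have fitR := fitting_property_matrix ltR fpR.
have fitS := matrix_fitting_converse (fitting_property_matrix ltS fpS).
have M_sep m : (forall I J, open_ideals I -> open_ideals J ->
    [set x + y | x in bimod_lideal_mul I M & y in bimod_rideal_mul M J] m) ->
    m = 0.
  move=> Hm; suff : [set 0] m by [].
  by rewrite -hM => -[I J] [/= oI oJ]; exact: Hm.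
have ex_w : exchange w.
  apply: (@fitting_exchange _ _ _ w (@nbhs_ideals R) FS) => //.
  - by move=> a; exact: hausdorff_lmod_sep.
  - move=> b Jb; suff : [set 0] b by [].
    by rewrite -hB => J /open_nbhs_ideals/Jb.
  (* An element of every I M lies in every I M + M J, so joint separation gives one-sided
     separation. *)
  - move=> m Hm; apply: M_sep => I J /open_nbhs_ideals/Hm Im _.
    by exists m => //; exists 0; [exact: add_span0 | rewrite addr0].
  - move=> m Hm; apply: M_sep => I J _ /open_nbhs_ideals/Hm Jm.
    by exists 0; [exact: add_span0 | exists m => //; rewrite add0r].
  - by move=> f; exact: finitely_presented_fitting.
  - by move=> f; exact: finitely_presented_fitting.
have [s [locs spans]] := local_generators (semiperfect_left spR) fA.
have [s' [locs' spans']] := local_generators (semiperfect_right spS) fB.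
split=> [|t t' u u' indu /isometric_orthogonal_sums du indu'
          /isometric_orthogonal_sums du'].
  have [t [u [indu du]]] :=
    sumdec_exists (idempotent_bound_exists locs spans locs' spans').
  by exists t, u; split=> //; exact/isometric_orthogonal_sums.
have [tt' [sigma [sigma_bij uu']]] := krull_schmidt ex_w indu du indu' du'.
by split=> //; exists sigma; split=> // i; exact/isometric_piso.
Qed.
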